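(* Let $\mathbb{F}$ be a field and let $R(s)\in\mathbb{F}(s)^{m\times n}$ be a rational matrix with $\operatorname{rank}(R(s))=r$. Let $\tilde p_1\le\dots\le\tilde p_r$ be the invariant orders at $\infty$ and $\mathbf{c}=(c_1,\dots,c_{n-r})$ the column minimal indices of $R(s)$. Let $z$ and $x$ be integers such that $0\le x\le\min\{z,n-r\}$, let $\tilde q_1\le\dots\le\tilde q_{r+x}$ be integers, and let $\mathbf{d}=(d_1,\dots,d_{n-r-x})$ be a partition. Let $h_x=\min\{i: d_{i-x+1}<c_i\}$. There exists $\widetilde W(s)\in\mathbb{F}(s)^{z\times n}$ such that $\operatorname{rank}\begin{bmatrix}R(s)\\\widetilde W(s)\end{bmatrix}=r+x$ and $\begin{bmatrix}R(s)\\\widetilde W(s)\end{bmatrix}$ has $\tilde q_1,\dots,\tilde q_{r+x}$ as invariant orders at $\infty$ and $\mathbf{d}$ as column minimal indices if and only if $$d_i=c_{i+x},\quad h_x-x+1\le i\le n-r-x,$$ and $$\tilde q_i\le\tilde p_i\le\tilde q_{i+z},\quad 1\le i\le r.$$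
   Context: Structural data. $\mathbb{F}(s)$ is the field of rational functions over $\mathbb{F}$, $\mathbb{F}_{pr}(s)$ the ring of proper rational functions (degree of denominator at least degree of numerator). The rank of a matrix is its rank over $\mathbb{F}(s)$. For an $m\times n$ rational matrix of rank $r$, the invariant orders at $\infty$ are the integers $\tilde p_1\le\dots\le\tilde p_r$ such that the matrix equals $B_1(s)\begin{bmatrix}\operatorname{diag}(s^{-\tilde p_1},\dots,s^{-\tilde p_r})&0\\0&0\end{bmatrix}B_2(s)$ with $B_1,B_2$ square matrices over $\mathbb{F}_{pr}(s)$ that are invertible over $\mathbb{F}_{pr}(s)$. For a subspace of $\mathbb{F}(s)^{k\times 1}$, a minimal basis is a basis of polynomial vectors whose sum of degrees is least among all polynomial bases; the degrees of its vectors (independent of the choice) are the minimal indices of the subspace. The column minimal indices of $R(s)\in\mathbb{F}(s)^{m\times n}$ are the minimal indices of $\{y\in\mathbb{F}(s)^{n\times1}:R y=0\}$, always listed in decreasing order; there are $n-r$ of them if $R$ has rank $r$. Conventions. ''Decreasing'' and ''increasing'' are meant in the weak sense. A partition is a decreasing sequence of nonnegative integers (possibly empty). A decreasing sequence $a_1\ge\dots\ge a_k$ is extended by $a_i=+\infty$ for $i<1$ and $a_i=-\infty$ for $i>k$; an increasing sequence $b_1\le\dots\le b_k$ is extended by $b_i=-\infty$ for $i<1$ and $b_i=+\infty$ for $i>k$. (So if $x=0$ then $h_0=0$.) A condition over an empty index range is trivially satisfied. *)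

(* Defs.v *)
From HB Require Import structures.
From mathcomp Require Import all_boot all_order all_algebra.
From mathcomp Require Import constructive_ereal.

Set Implicit Arguments.
Unset Strict Implicit.
Unset Printing Implicit Defensive.

Import Order.TTheory GRing.Theory Num.Theory.

Local Open Scope ring_scope.

Notation ratfun F := {fraction {poly F}}.

Section RationalMatrices.

Variable F : fieldType.

(* size is degree + 1 (and size 0 = 0), so comparing sizes compares degrees. *)
Definition proper (x : ratfun F) : Prop :=
  exists2 pq : {poly F} * {poly F},
    pq.2 != 0 /\ (size pq.1 <= size pq.2)%N & x = tofrac pq.1 / tofrac pq.2.

Definition proper_mx (m n : nat) (A : 'M[ratfun F]_(m, n)) : Prop :=
  forall i j, proper (A i j).

Definition biproper_mx (n : nat) (B : 'M[ratfun F]_n) : Prop :=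
  [/\ proper_mx B, B \in unitmx & proper_mx (invmx B)].

Definition smith_infty (m n : nat) (p : seq int) : 'M[ratfun F]_(m, n) :=
  \matrix_(i, j)
    if (i == j :> nat) && (i < size p)%N then tofrac 'X ^ (- p`_i) else 0.

Definition invariant_orders_infty (m n : nat) (A : 'M[ratfun F]_(m, n))
    (p : seq int) : Prop :=
  [/\ sorted <=%R p, size p = \rank A
    & exists B1 : 'M[ratfun F]_m, exists B2 : 'M[ratfun F]_n,
        [/\ biproper_mx B1, biproper_mx B2
          & A = B1 *m smith_infty m n p *m B2]].

Definition vdeg (k : nat) (v : 'cV[{poly F}]_k) : nat :=
  \max_(i < k) (size (v i ord0)).-1.

Definition poly_basis (k : nat) (U : {vspace 'cV[ratfun F]_k})
    (b : seq 'cV[{poly F}]_k) : Prop :=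
  basis_of U [seq map_mx (@tofrac {poly F}) v | v <- b].

Definition minimal_basis (k : nat) (U : {vspace 'cV[ratfun F]_k})
    (b : seq 'cV[{poly F}]_k) : Prop :=
  poly_basis U b /\
  forall b', poly_basis U b' ->
    (\sum_(v <- b) vdeg v <= \sum_(v <- b') vdeg v)%N.

Definition minimal_indices (k : nat) (U : {vspace 'cV[ratfun F]_k})
    (c : seq nat) : Prop :=
  sorted geq c /\
  exists2 b, minimal_basis U b & perm_eq c [seq vdeg v | v <- b].

Definition col_minimal_indices (m n : nat) (A : 'M[ratfun F]_(m, n))
    (c : seq nat) : Prop :=
  minimal_indices (lker (linfun (mulmx A : 'cV[ratfun F]_n -> 'cV[ratfun F]_m))) c.

End RationalMatrices.

(* 1-based indexing by integers, with infinite values out of range. *)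
Definition decr_ext (a : seq nat) (i : int) : \bar int :=
  if i < 1 then +oo%E
  else if (size a)%:Z < i then -oo%E
  else ((nth 0%N a `|i - 1|%N)%:Z)%:E.

Definition incr_ext (b : seq int) (i : int) : \bar int :=
  if i < 1 then -oo%E
  else if (size b)%:Z < i then +oo%E
  else (nth 0 b `|i - 1|%N)%:E.

(* h = min {i : d_(i-x+1) < c_i}, the minimum being over all integers i. *)
Definition is_hx (c d : seq nat) (x : nat) (h : int) : Prop :=
  (decr_ext d (h - x%:Z + 1) < decr_ext c h)%E /\
  forall i : int, (decr_ext d (i - x%:Z + 1) < decr_ext c i)%E -> h <= i.

Lemma ex_hx (c d : seq nat) (x : nat) :
  (size d + x = size c)%N -> exists h : int, is_hx c d x h.
Proof.
move=> hs; pose P i := (decr_ext d (i - x%:Z + 1) < decr_ext c i)%E.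
have exP : exists n : nat, P n%:Z.
  case: x hs @P => [|x] hs P.
    exists 0%N; rewrite /P /decr_ext.
    have -> : 0%:Z - 0%:Z + 1 = 1 :> int by [].
    by rewrite (ltxx (1 : int)); case: ifP => _ //; rewrite ltry.
  exists (size c); rewrite /P /decr_ext -hs ltxx.
  have -> : (size d + x.+1)%N%:Z - x.+1%:Z + 1 = (size d)%:Z + 1.
    by rewrite PoszD addrK.
  rewrite [_ + 1 < 1]gtrDr [_ < 0]ltNge lez_nat leq0n /= ltrDl ltr01.
  by case: ifP => // _; rewrite ltNyr.
have Pneg i : i < 0 -> ~~ P i.
  move=> i0; rewrite /P {1}/decr_ext.
  suff -> : i - x%:Z + 1 < 1 by rewrite -leNgt leey.
  by rewrite gtrDr subr_lt0 (lt_le_trans i0).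
case: (ex_minnP exP) => k Pk kmin; exists k%:Z; split=> // i Pi.
case: (ltP i 0) => [/Pneg|i0]; first by move=> /negP.
by case: i i0 Pi => // i _ Pi; rewrite lez_nat kmin.
Qed.

(* Main.v *)
Require Import Defs.
From HB Require Import structures.
From mathcomp Require Import all_boot all_order all_algebra.
From mathcomp Require Import constructive_ereal.
From mathcomp Require Import generic_quotient perm zify.

Set Implicit Arguments.
Unset Strict Implicit.
Unset Printing Implicit Defensive.

Import Order.TTheory GRing.Theory Num.Theory.

Local Open Scope ring_scope.

(** Let U be the kernel of R. A completion of R by rows cuts out a subspace V of
U, and the proof separates the two kinds of data: the column minimal indices
depend on V only, while the invariant orders only see the matrices up to
multiplication by biproper ones. The two halves are glued by
[row_completion_exists]: every subspace V of U of codimension x is the kernel of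
a completion with invariant orders q, as soon as q and p interlace.

Minimal indices. All that is used of a minimal basis b of U is the exchange
property [degree_dominant]: a polynomial vector of U has coordinate zero along
every vector of b of larger degree, for otherwise it could replace that vector.
Conversely dominance gives minimality, because a transition matrix has a nonzero
term in its Leibniz expansion, which matches the vectors of two bases.
For the necessity ([subspace_degrees]), the inequality at h says that the last
vectors of a minimal basis of V have degree less than c_h. By dominance they lie
in the span of the last vectors of a minimal basis of U. There are equally many
of both, so the spans agree and so do the degrees.
For the sufficiency, let u be a minimal basis of U with degrees c, and let V be
spanned by the vectors s^e u_(j+x-1) + u_(j+x) of degree d_j for j <= h-x,
followed by the vectors u_(j+x) for j > h-x. Dominance of u implies that a
polynomial vector of U has polynomial coordinates and that leading terms never
cancel ([dominant_coord_poly], [dominant_coord_degree]). The bidiagonal shape of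
the change of vectors carries the dominance over to the basis of V
([mixed_degree]).

Invariant orders. The proper rational functions form a local ring whose maximal
ideal is generated by 1/s. If a Smith form at infinity with orders q equals
G S H + E with S the Smith form of orders p, G and H proper, and E of rank at
most z, then p_i <= q_(i+z): otherwise a scaled corner of size i+z of the left
side, which is the identity, would be congruent modulo 1/s to a matrix of rank
less than i+z ([smith_interlace]). Reading R off its completion, and the
completion off R, gives both inequalities.
For the converse, a biproper change of coordinates makes V the space of vectors
whose first r+x coordinates vanish ([clear_rows]), and then an explicit banded
matrix does the job ([smith_stack]). *)

(** * Indices and their infinite extensions *)

Lemma decr_ext_le0 a (i : int) : i <= 0 -> decr_ext a i = +oo%E.
Proof. by rewrite /decr_ext -ltzD1 add0r => ->. Qed.

Lemma decr_extS a (i : nat) :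
  decr_ext a i.+1%:Z = if (i < size a)%N then (nth 0%N a i)%:Z%:E else -oo%E.
Proof.
have e : `|i.+1%:Z - 1|%N = i by lia.
rewrite /decr_ext e ltNge lez_nat ltz_nat /=.
by case: (ltnP i) => h; [rewrite ltnS leqNgt h | rewrite ltnS h].
Qed.

Lemma incr_extS b (i : nat) :
  incr_ext b i.+1%:Z = if (i < size b)%N then (b`_i)%:E else +oo%E.
Proof.
have e : `|i.+1%:Z - 1|%N = i by lia.
rewrite /incr_ext e ltNge lez_nat ltz_nat /=.
by case: (ltnP i) => h; [rewrite ltnS leqNgt h | rewrite ltnS h].
Qed.

Lemma sorted_geq_nth (s : seq nat) i j :
  sorted geq s -> (i <= j)%N -> (j < size s)%N -> (nth 0%N s j <= nth 0%N s i)%N.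
Proof.
move=> ss ij js.
apply: (@sorted_leq_nth _ geq (fun y x z h1 h2 => leq_trans h2 h1) leqnn 0%N _ ss) => //.
by rewrite inE (leq_ltn_trans ij).
Qed.

(** The natural number g = h - x counts the entries of d that may differ from the
tail of c. Minimality of h bounds the first g entries of d from below, and the
inequality at h separates the others from the first h entries of c. *)
Lemma is_hx_nat (c d : seq nat) x (h : int) :
  (size d + x)%N = size c -> sorted geq c -> is_hx c d x h ->
  exists g : nat, [/\ h = (g + x)%N%:Z, (g <= size d)%N,
    forall l, (l < g + x)%N -> (g < size d)%N -> (nth 0%N d g < nth 0%N c l)%N &
    forall j, (j < g)%N -> (0 < x)%N /\ (nth 0%N c (j + x).-1 <= nth 0%N d j)%N].
Proof.
move=> sdc sc [hP hmin].
have xh : x%:Z <= h.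
  rewrite leNgt; apply/negP => hx; move: hP; rewrite decr_ext_le0 ?ltNge ?leey //.
  lia.
have [g hg] : exists g : nat, h = (g + x)%N%:Z by exists `|h - x%:Z|%N; lia.
have eg i : (i + x)%N%:Z - x%:Z + 1 = i.+1%:Z :> int by lia.
rewrite hg eg decr_extS in hP.
have gd : (g <= size d)%N.
  have : h <= (size d + x)%N%:Z.
    apply: hmin; rewrite eg decr_extS ltnn.
    case e : (size d + x)%N => [|s]; first by rewrite decr_ext_le0.
    by rewrite decr_extS -sdc e ltnSn ltNyr.
  by rewrite hg; lia.
exists g; split=> // [l lg gs|j jg].
  move: hP; rewrite gs; case e : (g + x)%N => [|s]; first by move: lg; rewrite e.
  have ss : (s < size c)%N by rewrite -sdc -e leq_add2r.
  rewrite decr_extS ss lte_fin ltz_nat => /leq_trans; apply.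
  by apply: sorted_geq_nth => //; move: lg; rewrite e.
have Pj : ~ (decr_ext d j.+1%:Z < decr_ext c (j + x)%N%:Z)%E.
  by rewrite -eg => /hmin; rewrite hg lez_nat leq_add2r leqNgt jg.
have jd : (j < size d)%N by apply: leq_trans gd.
(* for x = 0 the convention that c has an infinite entry at 0 forces h = 0 *)
have x0 : (0 < x)%N.
  case: x {sdc xh eg Pj} hg hmin {hP} => // hg hmin.
  suff : h <= 0 by rewrite hg addn0 lez_nat leqn0 => /eqP g0; move: jg; rewrite g0.
  apply: hmin; rewrite [decr_ext c 0]decr_ext_le0 // (_ : 0 - 0%:Z + 1 = 1%:Z) // decr_extS.
  by case: ifP => _; rewrite ?ltry.
split=> //; move: Pj; case e : (j + x)%N => [|s]; first by move: x0 e; lia.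
have ss : (s < size c)%N by rewrite -sdc -e leq_add2r ltnW.
by rewrite !decr_extS jd ss lte_fin ltz_nat => /negP; rewrite -leqNgt.
Qed.

Lemma decr_ext_tail (c d : seq nat) x (g : nat) (t : int) :
  (size d + x)%N = size c -> t = (size d)%:Z ->
  (forall i : int, (g + x)%N%:Z - x%:Z + 1 <= i -> i <= t ->
     decr_ext d i = decr_ext c (i + x%:Z)) <->
  (forall j, (g <= j < size d)%N -> nth 0%N d j = nth 0%N c (j + x)).
Proof.
move=> sdc ->; split=> [h j /andP[gj jd]|h i gi id].
  have := h j.+1%:Z; rewrite -PoszD addSn !decr_extS jd -sdc ltn_add2r jd.
  by move=> e; have [] : _ := e ltac:(lia) ltac:(lia).
have [j e] : exists j, i = j.+1%:Z by exists `|i - 1|%N; lia.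
rewrite e -PoszD addSn !decr_extS -sdc ltn_add2r.
have jd : (j < size d)%N by lia.
by rewrite jd h //; lia.
Qed.

Lemma incr_ext_interlace (p q : seq int) r x z :
  size p = r -> size q = (r + x)%N ->
  (forall i : int, 1 <= i -> i <= r%:Z ->
      (incr_ext q i <= incr_ext p i)%E /\
      (incr_ext p i <= incr_ext q (i + z%:Z))%E) <->
  (forall i, (i < r)%N -> q`_i <= p`_i /\ ((i + z < r + x)%N -> p`_i <= q`_(i + z))).
Proof.
move=> sp sq; split=> [h i ir|h i i1 ir].
  have [] := h i.+1%:Z; try lia.
  rewrite -PoszD addSn !incr_extS sp sq ir ltn_addr // lee_fin => -> h2; split=> // iz.
  by move: h2; rewrite iz lee_fin.
have [j e] : exists j, i = j.+1%:Z by exists `|i - 1|%N; lia.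
have jr : (j < r)%N by lia.
rewrite e -PoszD addSn !incr_extS sp sq jr ltn_addr // lee_fin.
have [-> h2] := h j jr; split=> //; case: ifP => iz; last by rewrite leey.
by rewrite lee_fin h2.
Qed.

Section RationalMatrices.

Variable F : fieldType.
Local Notation K := (ratfun F).
Local Notation "p %:F" := (@tofrac {poly F} p).
Local Notation proper := (@Defs.proper F).
(** The indeterminate, as a rational function. *)
Local Notation T := ('X%:F : K).
Local Notation psize := (@size (GRing.Field.sort F)).
Local Notation tofv := (map_mx (@tofrac {poly F})).

(** * Rational functions and the ring of proper ones *)

(** These restate general lemmas on sizes with the coefficient type presented as
the carrier of the field F, so that arithmetic tactics identify the sizes. *)
Lemma size_mulf (p q : {poly F}) :
  p != 0 -> q != 0 -> psize (p * q) = (psize p + psize q).-1.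
Proof. exact: size_mul. Qed.

Lemma psize_gt0 (p : {poly F}) : (0 < psize p)%N = (p != 0).
Proof. exact: size_poly_gt0. Qed.

Lemma size_mulf_leq (p q : {poly F}) : (psize (p * q)%R <= (psize p + psize q).-1)%N.
Proof. exact: size_polyMleq. Qed.

Lemma ratfun_quot (x : K) :
  exists2 ab : {poly F} * {poly F}, ab.2 != 0 & x = ab.1%:F / ab.2%:F.
Proof.
elim/quotW: x => a; exists (frac a); first exact: denom_ratioP.
apply: canRL (mulfK _) _; first by rewrite tofrac_eq0 denom_ratioP.
rewrite piE [tofrac \n_a]piE.
apply/eqmodP; rewrite /= FracField.equivfE /FracField.mulf.
rewrite !numden_Ratio ?oner_eq0 ?mulr1 ?denom_ratioP //.
by rewrite mulrC.
Qed.

Lemma common_denom (I : finType) (f : I -> K) :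
  exists g : {poly F}, exists a : I -> {poly F},
    g != 0 /\ forall i, f i = (a i)%:F / g%:F.
Proof.
have [ab abP] : exists ab : I -> {poly F} * {poly F},
    forall i, (ab i).2 != 0 /\ f i = (ab i).1%:F / (ab i).2%:F.
  apply: (@fin_all_exists _ (fun=> ({poly F} * {poly F})%type)
            (fun i u => u.2 != 0 /\ f i = u.1%:F / u.2%:F)) => i.
  by have [u u0 ->] := ratfun_quot (f i); exists u.
exists (\prod_i (ab i).2), (fun i => (ab i).1 * \prod_(j | j != i) (ab j).2).
split=> [|i]; first by apply/prodf_neq0 => i _; case: (abP i).
have [_ ->] := abP i; rewrite [\prod_j _](bigD1 i) //= !rmorphM -mulf_div divff ?mulr1 //.
by rewrite tofrac_eq0; apply/prodf_neq0 => j _; case: (abP j).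
Qed.

Lemma T_neq0 : T != 0. Proof. by rewrite tofrac_eq0 polyX_eq0. Qed.

Lemma proper_poly (p q : {poly F}) :
  q != 0 -> (size p <= size q)%N -> proper (p%:F / q%:F).
Proof. by exists (p, q). Qed.

Lemma proper_zero : proper 0.
Proof. by exists (0, 1); rewrite ?oner_eq0 ?size_poly0 //= rmorph0 mul0r. Qed.

Lemma proper_one : proper 1.
Proof. by exists (1, 1); rewrite ?oner_eq0 //= divff // oner_eq0. Qed.

Lemma proper_opp (x : K) : proper x -> proper (- x).
Proof.
by move=> [[a b] [/= b0 /= s] ->]; exists (- a, b); rewrite ?size_polyN //= rmorphN mulNr.
Qed.

Lemma proper_mul (x y : K) : proper x -> proper y -> proper (x * y).
Proof.
move=> [[a b] [/= b0 /= s] ->] [[c d] [/= d0 /= s'] ->].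
rewrite mulf_div -!rmorphM; apply: proper_poly; first by rewrite mulf_neq0.
have [->|a0] := eqVneq a 0; first by rewrite mul0r size_poly0.
have [->|c0] := eqVneq c 0; first by rewrite mulr0 size_poly0.
by rewrite !size_mulf //; lia.
Qed.

Lemma proper_add (x y : K) : proper x -> proper y -> proper (x + y).
Proof.
move=> [[a b] [/= b0 /= s] ->] [[c d] [/= d0 /= s'] ->].
rewrite addf_div ?tofrac_eq0 // -!rmorphM -rmorphD.
apply: proper_poly; first by rewrite mulf_neq0.
apply: leq_trans (size_polyD _ _) _; rewrite geq_max (size_mulf b0 d0).
have mono (u v : {poly F}) k : (psize u <= k)%N -> (psize (u * v)%R <= (k + psize v).-1)%N.
  by move=> h; have := size_mulf_leq u v; lia.
by rewrite mono // addnC mono.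
Qed.

Lemma proper_sum (I : Type) (r : seq I) (P : pred I) (f : I -> K) :
  (forall i, P i -> proper (f i)) -> proper (\sum_(i <- r | P i) f i).
Proof. by move=> h; elim/big_ind: _ => //; [exact: proper_zero | exact: proper_add]. Qed.

Lemma proper_prod (I : Type) (r : seq I) (P : pred I) (f : I -> K) :
  (forall i, P i -> proper (f i)) -> proper (\prod_(i <- r | P i) f i).
Proof. by move=> h; elim/big_ind: _ => //; [exact: proper_one | exact: proper_mul]. Qed.

Lemma proper_nat n : proper n%:R.
Proof.
by elim: n => [|n IH]; [exact: proper_zero | rewrite mulrS; apply: proper_add proper_one IH].
Qed.

Lemma proper_sign n : proper ((-1) ^+ n).
Proof.
elim: n => [|n IH]; first exact: proper_one.
by rewrite exprS; apply: proper_mul IH; apply/proper_opp/proper_one.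
Qed.

(** Proper rational functions form a valuation ring: clearing denominators turns
the valuation into a degree, and the entry of largest degree divides all others. *)
Lemma proper_pivot (I : finType) (u : I -> K) i0 : u i0 != 0 ->
  exists j, u j != 0 /\ forall l, proper (u l / u j).
Proof.
have [g [a [g0 ha]]] := common_denom u.
have a0 l : (a l == 0) = (u l == 0).
  by rewrite ha mulf_eq0 invr_eq0 !tofrac_eq0 (negPf g0) orbF.
move=> u0; pose j := [arg max_(j > i0) psize (a j)]%N.
have jP l : (psize (a l) <= psize (a j))%N by rewrite /j; case: arg_maxnP => // i _; apply.
have aj : a j != 0 by rewrite -psize_gt0 (leq_trans _ (jP i0)) // psize_gt0 a0.
exists j; split=> [|l]; first by rewrite -a0.
rewrite !ha -mulf_div divff ?mulr1 ?invr_eq0 ?tofrac_eq0 //.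
exact: proper_poly.
Qed.

Lemma expTD (a b : int) : T ^ a * T ^ b = T ^ (a + b).
Proof. by rewrite expfzDr ?T_neq0. Qed.

Lemma proper_T (k : int) : k <= 0 -> proper (T ^ k).
Proof.
case: k => [[_|//]|k _]; first by rewrite expr0z; exact: proper_one.
rewrite NegzE -exprnN; exists (1, 'X^(k.+1)) => /=; last first.
  by rewrite rmorph1 div1r rmorphXn.
by rewrite size_polyXn size_poly1 -size_poly_eq0 size_polyXn.
Qed.

(** Equivalently, 1/s is not invertible in the ring of proper functions, so that
this ring is not the whole field. *)
Lemma T_not_proper : ~ proper T.
Proof.
move=> [[a b] [/= b0 s]] e.
have /eqP : 'X%:F * b%:F = a%:F by rewrite e divfK // tofrac_eq0.
rewrite -rmorphM tofrac_eq => /eqP eab.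
by move: s; rewrite -eab size_mulf ?polyX_eq0 // size_polyX /= ltnn.
Qed.

(** * Biproper matrices and Smith forms at infinity *)

Lemma proper_mulmx m n p (A : 'M[K]_(m, n)) (B : 'M[K]_(n, p)) :
  proper_mx A -> proper_mx B -> proper_mx (A *m B).
Proof. by move=> hA hB i j; rewrite mxE; apply: proper_sum => k _; apply: proper_mul. Qed.

Lemma proper_mx1 n : proper_mx (1%:M : 'M[K]_n).
Proof. by move=> i j; rewrite mxE; apply: proper_nat. Qed.

Lemma proper_det n (A : 'M[K]_n) : proper_mx A -> proper (\det A).
Proof.
move=> hA; rewrite /determinant; apply: proper_sum => s _.
by apply: proper_mul (proper_sign _) _; apply: proper_prod.
Qed.

Lemma biproper_inv n (A A' : 'M[K]_n) :
  proper_mx A -> proper_mx A' -> A *m A' = 1%:M -> biproper_mx A.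
Proof.
move=> pA pA' e; have [uA _] := mulmx1_unit e; split=> //.
by rewrite -[invmx A]mulmx1 -e mulKmx.
Qed.

Lemma biproper_mx1 n : biproper_mx (1%:M : 'M[K]_n).
Proof. by apply: (@biproper_inv _ _ 1%:M); rewrite ?mulmx1 //; apply: proper_mx1. Qed.

Lemma biproper_mulmx n (A B : 'M[K]_n) :
  biproper_mx A -> biproper_mx B -> biproper_mx (A *m B).
Proof.
move=> [pA uA pA'] [pB uB pB'].
apply: (@biproper_inv _ _ (invmx B *m invmx A)).
- exact: proper_mulmx.
- exact: proper_mulmx.
- by rewrite mulmxA (mulmxK uB) (mulmxV uA).
Qed.

Lemma biproper_invmx n (A : 'M[K]_n) : biproper_mx A -> biproper_mx (invmx A).
Proof. by move=> [pA uA pA']; split; rewrite ?unitmx_inv ?invmxK. Qed.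

(** The adjugate of a proper matrix is proper, so only the determinant has to be
inverted. *)
Lemma biproper_det n (A : 'M[K]_n) :
  proper_mx A -> \det A != 0 -> proper (\det A)^-1 -> biproper_mx A.
Proof.
move=> pA d0 pd; have uA : A \in unitmx by rewrite unitmxE unitfE.
split=> // i j; rewrite /invmx uA !mxE; apply: proper_mul => //.
apply: proper_mul; first exact: proper_sign.
by apply: proper_det => k l; rewrite !mxE.
Qed.

Lemma biproper_block m z (B : 'M[K]_m) :
  biproper_mx B -> biproper_mx (block_mx B 0 0 1%:M : 'M[K]_(m + z)).
Proof.
move=> [pB uB pB'].
have pblock (C : 'M[K]_m) : proper_mx C -> proper_mx (block_mx C 0 0 1%:M : 'M[K]_(m + z)).
  move=> pC i j; rewrite !mxE; case: splitP => k _; rewrite !mxE; case: splitP => l _; rewrite ?mxE.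
  - exact: pC.
  - exact: proper_zero.
  - exact: proper_zero.
  - exact: proper_nat.
apply: (@biproper_inv _ _ (block_mx (invmx B) 0 0 1%:M)).
- exact: pblock.
- exact: pblock.
- by rewrite mulmx_block !mulmx0 !mul0mx !addr0 !add0r (mulmxV uB) mulmx1 -scalar_mx_block.
Qed.

Lemma smith_infty_diag m n (p : seq int) :
  smith_infty F m n p = diag_mx (\row_(i < m) T ^ (- p`_i)) *m pid_mx (size p).
Proof.
by apply/matrixP => i j; rewrite mul_diag_mx !mxE; case: ifP => _; rewrite ?mulr1 ?mulr0.
Qed.

Lemma rank_pid_mx_leq m n r : (\rank (pid_mx r : 'M[K]_(m, n)) <= r)%N.
Proof.
rewrite -(pid_mx_id K m n (leqnn r)).
by apply: leq_trans (mxrankM_maxl _ _) _; apply: rank_leq_col.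
Qed.

Lemma rank_smith_leq m n p : (\rank (smith_infty F m n p) <= size p)%N.
Proof.
by rewrite smith_infty_diag; apply: leq_trans (mxrankM_maxr _ _) (rank_pid_mx_leq _ _ _).
Qed.

Lemma rank_smith m n p : (size p <= m)%N -> (size p <= n)%N ->
  \rank (smith_infty F m n p) = size p.
Proof.
move=> hm hn; rewrite smith_infty_diag eqmxMfull ?rank_pid_mx //.
rewrite row_full_unit unitmxE det_diag unitfE.
by apply/prodf_neq0 => i _; rewrite mxE expfz_neq0 // T_neq0.
Qed.

Lemma smith_mul_top m n t (p : seq int) (N : 'M[K]_(n, t))
    (i : 'I_m) (j : 'I_t) (ni : (i < n)%N) :
  (smith_infty F m n p *m N) i j =
    if (i < size p)%N then T ^ (- p`_i) * N (Ordinal ni) j else 0.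
Proof.
rewrite mxE (bigD1 (Ordinal ni)) //= big1 => [|l li].
  by rewrite mxE eqxx addr0 /=; case: ifP => _; rewrite ?mul0r.
rewrite mxE; case: eqP => [e|_]; last by rewrite mul0r.
by case/eqP: li; apply: val_inj.
Qed.

Lemma smith_mul0 m n t (p : seq int) (N : 'M[K]_(n, t)) :
  (forall (i : 'I_n) j, (i < size p)%N -> N i j = 0) -> smith_infty F m n p *m N = 0.
Proof.
move=> h; apply/matrixP => i j; rewrite [RHS]mxE mxE big1 // => l _; rewrite mxE.
by case: ifP => [/andP[/eqP e ip]|_]; rewrite ?mul0r // h ?mulr0 // -e.
Qed.

Lemma smith_mul_eq0 m n t (p : seq int) (N : 'M[K]_(n, t)) :
  (size p <= m)%N -> smith_infty F m n p *m N = 0 ->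
  forall (i : 'I_n) j, (i < size p)%N -> N i j = 0.
Proof.
move=> pm e i j ip; have im := leq_trans ip pm.
have := congr1 (fun A : 'M_(m, t) => A (Ordinal im) j) e.
rewrite /= (@smith_mul_top m n t p N (Ordinal im) j (ltn_ord i)) [RHS]mxE /= ip => /eqP.
rewrite mulf_eq0 expfz_eq0 (negPf T_neq0) andbF /= => /eqP <-.
by congr (N _ _); apply: val_inj.
Qed.

(** * Interlacing of invariant orders under row completion *)

(** The matrix is congruent to the identity modulo the maximal ideal. If a row
vector u were killed by it, dividing u = u Y / s by the entry of u of largest
degree would exhibit s as a sum of proper functions. *)
Lemma row_free_near1 n (Y : 'M[K]_n) : proper_mx Y -> row_free (1%:M - T^-1 *: Y).
Proof.
move=> pY; apply: inj_row_free => u; rewrite mulmxBr mulmx1 -scalemxAr => /eqP.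
rewrite subr_eq0 => /eqP eu; apply/eqP; case: (boolP (u == 0)) => // u0.
have [j0 j0P] : exists j, u 0 j != 0.
  apply/existsP; apply: contraNT u0; rewrite negb_exists => /forallP h; apply/eqP/rowP => j.
  by have /negPn/eqP -> := h j; rewrite mxE.
have [j [uj0 pj]] := proper_pivot j0P.
case: T_not_proper.
have -> : T = \sum_l (u 0 l / u 0 j) * Y l j.
  have := congr1 (fun M : 'rV_n => T * M 0 j / u 0 j) eu; rewrite /= mulfK // => ->.
  by rewrite !mxE mulVKf ?T_neq0 // mulr_suml; apply: eq_bigr => l _; rewrite mulrAC.
by apply: proper_sum => l _; apply: proper_mul.
Qed.

(** A min-max principle over the local ring of proper functions: perturbing by a
matrix of rank z shifts the invariant orders by at most z places. With z = 0 and
E = 0, multiplication by proper matrices can only increase the orders. *)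
Lemma smith_interlace m n m' n' (q p : seq int) z
    (G : 'M[K]_(m, m')) (H : 'M[K]_(n', n)) (E : 'M[K]_(m, n)) :
  sorted <=%R q -> sorted <=%R p -> (size q <= m)%N -> (size q <= n)%N ->
  proper_mx G -> proper_mx H -> (\rank E <= z)%N ->
  smith_infty F m n q = G *m smith_infty F m' n' p *m H + E ->
  forall i, (i + z < size q)%N -> (i < size p)%N /\ p`_i <= q`_(i + z).
Proof.
move=> sq sp qm qn pG pH rE eS i iz.
case: (boolP ((i < size p)%N && (p`_i <= q`_(i + z)))) => [/andP[]|bad] //.
have big l : (i <= l)%N -> (l < size p)%N -> q`_(i + z) + 1 <= p`_l.
  move=> il lp; have ip := leq_ltn_trans il lp; rewrite ip -ltNge in bad.
  rewrite lezD1; apply: lt_le_trans bad _.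
  by apply: (sorted_leq_nth le_trans le_refl 0 sp); rewrite ?inE.
(* After row scaling by D, the leading corner of size i+z+1 is the identity. *)
pose k := (i + z).+1; have km : (k <= m)%N by apply: leq_trans qm.
have kn : (k <= n)%N by apply: leq_trans qn.
pose f := widen_ord km; pose g := widen_ord kn.
pose D : 'M[K]_k := diag_mx (\row_a T ^ q`_a).
have D1 : D *m mxsub f g (smith_infty F m n q) = 1%:M.
  apply/matrixP => a b; rewrite mul_diag_mx !mxE /=.
  have -> : (a < size q)%N by apply: leq_trans iz; apply: ltn_ord.
  rewrite andbT -val_eqE /=; case: eqP => _; last by rewrite mulr0.
  by rewrite expTD subrr expr0z.
(* The orders from i on exceed those of the corner, so their part Sh contributes
   Y / s with Y proper; what remains has rank at most i+z. *)
pose Sl := smith_infty F m' n' (take i p).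
pose Sh := smith_infty F m' n' p - Sl.
pose N := D *m rowsub f G *m Sl *m colsub g H + D *m mxsub f g E.
pose Y := T *: (D *m rowsub f G *m Sh *m colsub g H).
have eSh l b : Sh l b =
    if (l == b :> nat) && (i <= l < size p)%N then T ^ (- p`_l) else 0.
  rewrite !mxE size_take_min leq_min; case: (l =P b :> nat) => _ /=; last by rewrite subrr.
  by case: ltnP => lp; case: ltnP => li //=; rewrite ?subrr ?subr0 // nth_take // subrr.
have eN : 1%:M - T^-1 *: Y = N.
  rewrite /Y scalerA mulVf ?T_neq0 // scale1r -D1 eS linearD /= mulmxDr.
  rewrite (mxsub_mul f g (G *m _)) -(mul_rowsub_mx f G) !mulmxA /N addrAC; congr (_ + _).
  by rewrite -mulmxBl -mulmxBr /Sh opprB addrC subrK.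
have rN : (\rank N <= i + z)%N.
  apply: leq_trans (mxrank_add _ _) _; apply: leq_add.
    apply: leq_trans (mxrankM_maxl _ _) _; apply: leq_trans (mxrankM_maxr _ _) _.
    by apply: leq_trans (rank_smith_leq _ _ _) _; rewrite size_take; case: ltnP => // /ltnW.
  apply: leq_trans (mxrankM_maxr _ _) _.
  rewrite -[E]mulmx1 mxsub_mul; apply: leq_trans (mxrankM_maxl _ _) _.
  by rewrite rowsubE; apply: leq_trans (mxrankM_maxr _ _) _.
have pY : proper_mx Y.
  rewrite /Y scalemxAl; apply: proper_mulmx; last by move=> a b; rewrite mxE.
  move=> a b; rewrite mxE mxE mulr_sumr; apply: proper_sum => l _.
  rewrite eSh; case: ifP => [/and3P[_ il lp]|_]; last by rewrite !mulr0; exact: proper_zero.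
  rewrite mul_diag_mx !mxE.
  have -> : T * (T ^ q`_a * G (f a) l * T ^ (- p`_l)) = T ^ (1 + q`_a - p`_l) * G (f a) l.
    by rewrite -!expTD expr1z (mulrAC _ (G _ _)) !mulrA.
  apply: proper_mul => //; apply: proper_T; rewrite subr_le0.
  apply: le_trans (big l il lp); rewrite addrC lerD2r.
  by apply: (sorted_leq_nth le_trans le_refl 0 sq); rewrite ?inE //;
    [exact: leq_trans (ltn_ord a) iz | rewrite -ltnS ltn_ord].
have := row_free_near1 pY; rewrite eN /row_free => /eqP eR.
by move: rN; rewrite eR ltnn.
Qed.

(** For q <= p, R consists of rows of the completion. For the shifted inequality,
the completion is R up to a proper factor and a correction of rank at most z, the
number of added rows. *)
Lemma orders_interlace m n z (R : 'M[K]_(m, n)) (W : 'M[K]_(z, n)) (p q : seq int) :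
  invariant_orders_infty R p -> invariant_orders_infty (col_mx R W) q ->
  forall i, (i < size p)%N ->
    q`_i <= p`_i /\ ((i + z < size q)%N -> p`_i <= q`_(i + z)).
Proof.
move=> [sp szp [B1 [B2 [bB1 bB2 eR]]]] [sq szq [C1 [C2 [bC1 bC2 eRW]]]] i ip.
have [pB1 uB1 pB1'] := bB1; have [pB2 uB2 pB2'] := bB2.
have [pC1 uC1 pC1'] := bC1; have [pC2 uC2 pC2'] := bC2.
split.
  have eS : smith_infty F m n p =
      (invmx B1 *m usubmx C1) *m smith_infty F (m + z) n q *m (C2 *m invmx B2) + 0.
    have -> : smith_infty F m n p = invmx B1 *m R *m invmx B2.
      by rewrite eR !mulmxA (mulVmx uB1) mul1mx (mulmxK uB2).
    have -> : R = usubmx C1 *m smith_infty F (m + z) n q *m C2.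
      by rewrite -[R](col_mxKu R W) eRW -!mul_usub_mx.
    by rewrite addr0 !mulmxA.
  have := @smith_interlace _ _ _ _ p q 0 _ _ _ sp sq _ _ _ _ _ eS i.
  rewrite addn0; case=> //.
  - by rewrite szp rank_leq_row.
  - by rewrite szp rank_leq_col.
  - by apply: proper_mulmx => // a b; rewrite mxE.
  - exact: proper_mulmx.
  - by rewrite mxrank0.
move=> iz.
have eS : smith_infty F (m + z) n q =
    (lsubmx (invmx C1) *m B1) *m smith_infty F m n p *m (B2 *m invmx C2) +
    rsubmx (invmx C1) *m (W *m invmx C2).
  have -> : smith_infty F (m + z) n q = invmx C1 *m col_mx R W *m invmx C2.
    by rewrite eRW !mulmxA (mulVmx uC1) mul1mx (mulmxK uC2).
  rewrite -{1}[invmx C1]hsubmxK mul_row_col mulmxDl {1}eR.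
  by rewrite !mulmxA.
have := @smith_interlace _ _ _ _ q p z _ _ _ sq sp _ _ _ _ _ eS i.
case=> //.
- by rewrite szq rank_leq_row.
- by rewrite szq rank_leq_col.
- by apply: proper_mulmx => // a b; rewrite mxE.
- exact: proper_mulmx.
- by apply: leq_trans (mxrankM_maxl _ _) (rank_leq_col _).
Qed.

(** * Reducing a subspace by biproper row operations *)

(** The rows of N satisfy one more linear relation with support beyond the first k
rows. Its coefficient of largest degree is normalized to 1, which makes the
others proper; after moving that coefficient to position k, the relation itself
serves as a biproper row operation producing a zero row. *)
Lemma clear_next_row n t (N : 'M[K]_(n, t)) k :
  (forall (i : 'I_n) j, (i < k)%N -> N i j = 0) -> (\rank N + k < n)%N ->
  exists Q : 'M[K]_n, [/\ biproper_mx Q,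
    forall (i j : 'I_n), (i < k)%N -> Q i j = (i == j)%:R &
    forall (i : 'I_n) j, (i < k.+1)%N -> (Q *m N) i j = 0].
Proof.
move=> N0 rN.
have kn : (k < n)%N by apply: leq_ltn_trans rN; rewrite leq_addl.
have [i0 [l0 [kl0 u0]]] : exists i0, exists l0 : 'I_n, (k <= l0)%N /\ kermx N i0 l0 != 0.
  case: (boolP [exists i0, exists l0 : 'I_n, (k <= l0)%N && (kermx N i0 l0 != 0)]).
    by move=> /existsP[i0 /existsP[l0 /andP[? ?]]]; exists i0, l0.
  rewrite negb_exists => /forallP h.
  have e : kermx N *m pid_mx k = kermx N.
    apply/matrixP => i l; rewrite mxE (bigD1 l) //= big1 ?addr0 => [|s sl].
      rewrite [pid_mx k _ _]mxE eqxx /=; case: ltnP => kl; rewrite ?mulr1 // mulr0.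
      have := h i; rewrite negb_exists => /forallP/(_ l).
      by rewrite kl negbK => /eqP ->.
    by rewrite [pid_mx k _ _]mxE val_eqE (negPf sl) mulr0.
  have := leq_trans (mxrankM_maxr (kermx N) _) (@rank_pid_mx_leq n n k).
  rewrite e mxrank_ker => h'; move: rN h'; move: (\rank N) => rk; clear; lia.
(* The first k rows of N vanish, so the relation may be cut off there. *)
pose u (l : 'I_n) : K := if (l < k)%N then 0 else kermx N i0 l.
have uN b : \sum_l u l * N l b = 0.
  have e : (kermx N *m N) i0 b = 0 by rewrite mulmx_ker mxE.
  apply: etrans e; rewrite [RHS]mxE.
  by apply: eq_bigr => l _; rewrite /u; case: ifP => // /N0 ->; rewrite !mulr0.
have ul0 : u l0 != 0 by rewrite /u ltnNge kl0.
have [j [uj pu]] := proper_pivot ul0.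
have kj : (k <= j)%N by move: uj; rewrite /u; case: ltnP; rewrite ?eqxx.
pose w l := u l / u j; have pw l : proper (w l) := pu l.
have wN b : \sum_l w l * N l b = 0.
  apply: etrans (mul0r (u j)^-1); rewrite -[X in _ = X / _](uN b) mulr_suml.
  by apply: eq_bigr => l _; rewrite mulrAC.
pose k0 := Ordinal kn.
(* D is nilpotent because its only nonzero row has a zero on the diagonal, hence
   1 + D has the proper inverse 1 - D. *)
pose D : 'M[K]_n := \matrix_(i, l) if (i == k0) && (l != k0) then w (tperm k0 j l) else 0.
have pD : proper_mx D by move=> i l; rewrite mxE; case: ifP => _ //; exact: proper_zero.
have D2 : D *m D = 0.
  apply/matrixP => i l; rewrite !mxE big1 // => s _; rewrite !mxE.
  by case: eqP => _ /=; rewrite ?mul0r //; case: (s =P k0) => [->|] /=; rewrite ?mul0r ?mulr0.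
pose Q := (1%:M + D) *m tperm_mx k0 j.
have QE p (M : 'M[K]_(n, p)) i b :
    (Q *m M) i b = M (tperm k0 j i) b + \sum_s D i s * M (tperm k0 j s) b.
  rewrite -mulmxA -xrowE mulmxDl mul1mx mxE [xrow _ _ M _ _]mxE [(D *m _) i b]mxE.
  by congr (_ + _); apply: eq_bigr => s _; rewrite [xrow _ _ M _ _]mxE.
have tpi (i : 'I_n) : (i < k)%N -> tperm k0 j i = i.
  move=> ik; rewrite tpermD //; apply: contraTneq ik => <- /=; first by rewrite ltnn.
  by rewrite -leqNgt.
have Di (i : 'I_n) s : (i < k)%N -> D i s = 0.
  by move=> ik; rewrite mxE; case: eqP => // e; move: ik; rewrite e ltnn.
exists Q; split.
- apply: biproper_mulmx.
    apply: (@biproper_inv _ _ (1%:M - D)).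
    + by move=> i l; rewrite mxE; apply: proper_add => //; apply: proper_mx1.
    + move=> i l; rewrite mxE; apply: proper_add; first exact: proper_mx1.
      by rewrite mxE; apply: proper_opp.
    + by rewrite mulmxBr mulmx1 mulmxDl mul1mx D2 addr0 addrK.
  have pt : proper_mx (tperm_mx k0 j : 'M[K]_n).
    by move=> i l; rewrite !mxE; apply: proper_nat.
  apply: (@biproper_inv _ _ (tperm_mx k0 j)) => //.
  by rewrite -perm_mxM tperm2 perm_mx1.
- move=> i l ik; rewrite -[Q]mulmx1 QE big1 => [|s _]; last by rewrite Di // mul0r.
  by rewrite tpi // addr0 mxE.
- move=> i b; rewrite ltnS leq_eqVlt => /orP[/eqP ik|ik]; last first.
    rewrite QE big1 => [|s _]; last by rewrite Di // mul0r.
    by rewrite tpi // addr0 N0.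
  have -> : i = k0 by apply: val_inj.
  apply: etrans (wN b); rewrite QE [RHS](reindex_inj (@perm_inj _ (tperm k0 j))) /=.
  rewrite [RHS](bigD1 k0) //=.
  rewrite tpermL /w divff // mul1r [X in _ + X = _](bigD1 k0) //= [D k0 k0]mxE !eqxx mul0r add0r.
  by congr (_ + _); apply: eq_bigr => s sk; rewrite mxE eqxx sk.
Qed.

Lemma clear_rows n t (N : 'M[K]_(n, t)) k x :
  (forall (i : 'I_n) j, (i < k)%N -> N i j = 0) -> (\rank N + (k + x) <= n)%N ->
  exists Q : 'M[K]_n, [/\ biproper_mx Q,
    forall (i j : 'I_n), (i < k)%N -> Q i j = (i == j)%:R &
    forall (i : 'I_n) j, (i < k + x)%N -> (Q *m N) i j = 0].
Proof.
move=> N0; elim: x => [|x IH] rN.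
  exists 1%:M; split=> [|i j _|i j]; last by rewrite mul1mx addn0; apply: N0.
    exact: biproper_mx1.
  by rewrite mxE.
have [|Q [bQ Qi QN]] := IH; first by apply: leq_trans rN; rewrite addnS leq_add2l leqnSn.
have [//|//|Q' [bQ' Qi' QN']] := @clear_next_row n t (Q *m N) (k + x).
  apply: leq_ltn_trans (_ : _ <= \rank N + (k + x))%N _; last by rewrite -addnS -addnS.
  by rewrite leq_add2r mxrankM_maxr.
exists (Q' *m Q); split=> [|i j ik|i j]; first exact: biproper_mulmx.
  rewrite mxE (bigD1 i) //= big1 => [|s si]; rewrite Qi' ?(leq_trans ik) ?leq_addr //.
    by rewrite eqxx mul1r addr0 Qi.
  by rewrite eq_sym (negPf si) mul0r.
by rewrite addnS -mulmxA; apply: QN'.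
Qed.

(** * Realizing interlacing invariant orders *)

(** Over the lattice with basis e_j of orders q_j, the rows of S_p U are
s^(-p_i) e_i + s^(-q_(i+z)) e_(i+z) for i < r, without the second term when
i+z >= r+x, and without the first one when z = 0. Together with the first z basis
rows s^(-q_k) e_k they generate the lattice: each row of the first kind allows
to solve for the row of index i+z. Thus the row operation is a permutation of a
unitriangular matrix L. The two inequalities between p and q are what makes L and
U proper. The last clause says that U does not disturb the coordinate subspace
that is to become the kernel. *)
Lemma smith_stack m n z r x (p q : seq int) :
  size p = r -> size q = (r + x)%N -> (r <= m)%N -> (r + x <= n)%N -> (x <= z)%N ->
  (forall i, (i < r)%N -> q`_i <= p`_i) ->
  (forall i, (i + z < r + x)%N -> p`_i <= q`_(i + z)) ->
  exists U : 'M[K]_n, exists B : 'M[K]_(m + z), [/\ biproper_mx U, biproper_mx B,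
    col_mx (smith_infty F m n p *m U) (smith_infty F z n q) = B *m smith_infty F (m + z) n q &
    forall t (N : 'M[K]_(n, t)),
      (forall (i : 'I_n) j, (i < r + x)%N -> N i j = 0) -> U *m N = N].
Proof.
move=> sp sq rm rn xz qp pq.
have rxz : (r + x <= m + z)%N by apply: leq_add.
pose U : 'M[K]_n := \matrix_(i, j) if i == j then 1 else
  if (j == (i + z)%N :> nat) && (j < r + x)%N then T ^ (p`_i - q`_j) else 0.
pose L : 'M[K]_(m + z) := \matrix_(a, b) if a == b then 1 else
  if (a == (b + z)%N :> nat) && (b < r)%N then T ^ (q`_b - p`_b) else 0.
have pU : proper_mx U.
  move=> i j; rewrite mxE; case: eqP => _; first exact: proper_one.
  case: ifP => [/andP[/eqP ji jr]|_]; last exact: proper_zero.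
  by apply: proper_T; rewrite subr_le0 ji pq // -ji.
have pL : proper_mx L.
  move=> i j; rewrite mxE; case: eqP => _; first exact: proper_one.
  case: ifP => [/andP[/eqP ji jr]|_]; last exact: proper_zero.
  by apply: proper_T; rewrite subr_le0 qp.
have dU : \det U = 1.
  rewrite -det_tr det_trig; first by rewrite big1 // => i _; rewrite !mxE eqxx.
  apply/is_trig_mxP => i j ij; rewrite !mxE -val_eqE /= gtn_eqF //.
  by case: eqP => //= e; move: ij; rewrite e ltnNge leq_addr.
have dL : \det L = 1.
  rewrite det_trig; first by rewrite big1 // => i _; rewrite !mxE eqxx.
  apply/is_trig_mxP => i j ij; rewrite !mxE -val_eqE /= ltn_eqF //.
  by case: eqP => //= e; move: ij; rewrite e ltnNge leq_addr.
(* Rows of the upper block come after the z rows of the lower one. *)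
pose f (a : 'I_(m + z)) : 'I_(m + z) := cast_ord (addnC z m)
  (match split a with inl i => rshift z i | inr k => lshift m k end).
have f_inj : injective f.
  move=> a b /cast_ord_inj; rewrite /f.
  case: splitP => i ai; case: splitP => j bj /(congr1 val) /= e; apply: val_inj => /=.
  - by rewrite ai bj; apply/eqP; rewrite -(eqn_add2l z) e.
  - by have := ltn_ord j; rewrite -e ltnNge leq_addr.
  - by have := ltn_ord i; rewrite e ltnNge leq_addr.
  - by rewrite ai bj e.
pose B := row_perm (perm f_inj) L.
exists U, B; split.
- by apply: biproper_det; rewrite ?dU ?oner_eq0 // invr1; apply: proper_one.
- have eB : \det B = (-1) ^+ perm f_inj by rewrite /B row_permE det_mulmx det_perm dL mulr1.
  apply: biproper_det; first by move=> i j; rewrite mxE.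
    by rewrite eB signr_eq0.
  by rewrite eB invr_sign; apply: proper_sign.
- have LS (a : 'I_(m + z)) (j : 'I_n) (jm : (j < r + x)%N) :
      (L *m smith_infty F (m + z) n q) a j = L a (Ordinal (leq_trans jm rxz)) * T ^ (- q`_j).
    rewrite mxE (bigD1 (Ordinal (leq_trans jm rxz))) //= big1 => [|b bj].
      by rewrite [smith_infty _ _ _ _ _ _]mxE /= eqxx sq jm addr0.
    rewrite [smith_infty _ _ _ _ _ _]mxE; case: eqP => [e|_]; last by rewrite mulr0.
    by case/eqP: bj; apply: val_inj.
  have LS0 (a : 'I_(m + z)) (j : 'I_n) : (r + x <= j)%N ->
      (L *m smith_infty F (m + z) n q) a j = 0.
    move=> jm; rewrite mxE big1 // => b _; rewrite [smith_infty _ _ _ _ _ _]mxE sq.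
    by case: eqP => [->|_]; rewrite ?(ltnNge j) ?jm /= mulr0.
  rewrite /B row_permE -mulmxA -row_permE; apply/matrixP => a j.
  rewrite [RHS]mxE permE /f [LHS]mxE; case: splitP => i ai.
    have -> : (smith_infty F m n p *m U) i j =
        if (i < r)%N then T ^ (- p`_i) * (if (i == j :> nat) then 1 else
          if (j == (i + z)%N :> nat) && (j < r + x)%N then T ^ (p`_i - q`_j) else 0) else 0.
      case: (ltnP i r) => ir; last first.
        by rewrite mxE big1 // => l _; rewrite mxE sp ltnNge ir andbF mul0r.
      have inn : (i < n)%N by apply: leq_trans ir (leq_trans (leq_addr _ _) rn).
      by rewrite (smith_mul_top _ _ _ inn) sp ir mxE -val_eqE.
    case: (ltnP j (r + x)) => jm; last first.
      rewrite LS0 // andbF; case: ltnP => // ir; case: eqP => [e|_]; last by rewrite mulr0.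
      by move: jm; rewrite -e leqNgt ltn_addr.
    rewrite LS mxE -val_eqE /= [(z + i)%N]addnC eqn_add2r andbT.
    case: (ltnP i r) => ir; last first.
      rewrite andbC; case: eqP => [e|_].
        by move: jm; rewrite -e ltnNge leq_add.
      by case: (i =P j :> nat) => [<-|]; rewrite ?ltnNge ?ir ?andbF ?mul0r.
    case: (i =P j :> nat) => [e|ij].
      rewrite mulr1; case: eqP => [e'|_].
        (* z = 0: both bands coincide and the inequalities give p_i = q_i *)
        have zi : (i + z)%N = i by rewrite e' e.
        rewrite mul1r -e; congr (T ^ (- _)); apply/le_anti.
        by rewrite qp // andbT -{2}zi pq // zi e.
      by rewrite -e ir /= expTD; congr (T ^ _); lia.
    rewrite /= [j == _ :> nat]eq_sym; case: eqP => e; last by rewrite mulr0 mul0r.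
    by rewrite mul1r expTD; congr (T ^ _); lia.
  case: (ltnP j (r + x)) => jm.
    rewrite LS !mxE -val_eqE /= sq; case: eqP => [e|_].
      by rewrite e jm mul1r.
    by rewrite (ltn_eqF (ltn_addl _ (ltn_ord i))) mul0r.
  rewrite LS0 // mxE sq; case: eqP => [->|] //=; by rewrite ltnNge jm.
- move=> t N N0; apply/matrixP => i j; rewrite mxE (bigD1 i) //= big1.
    by rewrite mxE eqxx mul1r addr0.
  move=> l li; rewrite mxE eq_sym (negPf li); case: andP => [[_ lr]|_]; last by rewrite mul0r.
  by rewrite N0 // mulr0.
Qed.

Lemma mem_lker m n (A : 'M[K]_(m, n)) (v : 'cV[K]_n) :
  (v \in lker (linfun (mulmx A : 'cV[K]_n -> 'cV[K]_m))) = (A *m v == 0).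
Proof. by rewrite memv_ker lfunE. Qed.

(** A basis of the kernel, written as rows, lies in the row kernel of the
transpose. *)
Lemma dim_lker_leq m n (A : 'M[K]_(m, n)) :
  (\dim (lker (linfun (mulmx A : 'cV[K]_n -> 'cV[K]_m))) <= n - \rank A)%N.
Proof.
set U := lker _; pose P : 'M[K]_(\dim U, n) := \matrix_(i, j) tnth (vbasis U) i j ord0.
rewrite -mxrank_tr -mxrank_ker.
have rP : \rank P = \dim U.
  apply/eqP; apply: inj_row_free => u uP; apply/rowP => i; rewrite mxE.
  have /freeP := basis_free (vbasisP U); move/(_ (fun i => u 0 i)); apply.
  apply/matrixP => j k; rewrite ord1 summxE mxE.
  have := congr1 (fun M : 'rV_n => M 0 j) uP; rewrite !mxE => e; apply: etrans e.
  by apply: eq_bigr => l _; rewrite !mxE -tnth_nth.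
rewrite -rP; apply: mxrankS; apply/sub_kermxP; apply/matrixP => i j.
have : tnth (vbasis U) i \in U by apply/vbasis_mem/mem_tnth.
rewrite mem_lker => /eqP/matrixP/(_ j ord0); rewrite !mxE => e; apply: etrans e.
by apply: eq_bigr => l _; rewrite !mxE mulrC.
Qed.

Lemma mulmx_col m n t (A : 'M[K]_(m, n)) (B : 'M[K]_(n, t)) j :
  A *m col j B = col j (A *m B).
Proof. by rewrite !colE mulmxA. Qed.

Lemma lker_col_mx m n z (R : 'M[K]_(m, n)) (W : 'M[K]_(z, n)) :
  (lker (linfun (mulmx (col_mx R W) : 'cV[K]_n -> 'cV[K]_(m + z))) <=
   lker (linfun (mulmx R : 'cV[K]_n -> 'cV[K]_m)))%VS.
Proof.
apply/subvP => v vRW; have := etrans (esym (mem_lker (col_mx R W) v)) vRW.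
rewrite mul_col_mx col_mx_eq0 => /andP[e _].
exact: etrans (mem_lker R v) e.
Qed.

(** In coordinates C adapted both to R and to V, R becomes S_p U and V the space of
vectors whose first r+x coordinates vanish. The added rows are the Smith form
with orders q in these coordinates; they vanish on V, and the rank leaves no room
for a larger kernel. *)
Lemma row_completion_exists m n r x z (R : 'M[K]_(m, n)) (p q : seq int)
    (V : {vspace 'cV[K]_n}) :
  invariant_orders_infty R p -> size p = r -> size q = (r + x)%N -> sorted <=%R q ->
  (x <= z)%N -> (\dim V + (r + x) = n)%N ->
  (V <= lker (linfun (mulmx R : 'cV[K]_n -> 'cV[K]_m)))%VS ->
  (forall i, (i < r)%N -> q`_i <= p`_i /\ ((i + z < r + x)%N -> p`_i <= q`_(i + z))) ->
  exists W : 'M[K]_(z, n),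
    [/\ \rank (col_mx R W) = (r + x)%N, invariant_orders_infty (col_mx R W) q &
        lker (linfun (mulmx (col_mx R W) : 'cV[K]_n -> 'cV[K]_(m + z))) = V].
Proof.
move=> [_ szp [B1 [B2 [bB1 bB2 eR]]]] sp sq sortq xz dV VR hpq.
have [_ uB1 _] := bB1; have [_ uB2 _] := bB2.
have rm : (r <= m)%N by rewrite -sp szp rank_leq_row.
have rn : (r + x <= n)%N by apply: leq_trans (leq_addl _ _) (eq_leq dV).
pose M : 'M[K]_(n, \dim V) := \matrix_(i, j) tnth (vbasis V) j i ord0.
have colM j : col j M = tnth (vbasis V) j by apply/matrixP => i k; rewrite ord1 !mxE.
have RM : R *m M = 0.
  apply/matrixP => i j; rewrite [RHS]mxE.
  have : tnth (vbasis V) j \in V by apply/vbasis_mem/mem_tnth.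
  move/(subvP VR); rewrite mem_lker -colM mulmx_col => /eqP/matrixP/(_ i ord0).
  by rewrite mxE => ->; rewrite mxE.
have N0 : forall (i : 'I_n) j, (i < r)%N -> (B2 *m M) i j = 0.
  rewrite -sp; apply: (smith_mul_eq0 (m := m)); first by rewrite sp.
  have -> : smith_infty F m n p *m (B2 *m M) = invmx B1 *m (R *m M).
    by rewrite eR !mulmxA (mulVmx uB1) mul1mx.
  by rewrite RM mulmx0.
have [|Q [bQ Qr QN]] := clear_rows (x := x) N0.
  by apply: leq_trans (eq_leq dV); rewrite leq_add2r rank_leq_col.
have [_ uQ _] := bQ.
(* Q fixes the first r rows, the only ones that the Smith form sees. *)
have SQ : smith_infty F m n p *m Q = smith_infty F m n p.
  apply/matrixP => i j; case: (ltnP i r) => ir; last first.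
    rewrite [RHS]mxE mxE big1 ?sp ?ltnNge ?ir ?andbF // => l _.
    by rewrite mxE sp ltnNge ir andbF mul0r.
  have ni : (i < n)%N by apply: leq_trans ir (leq_trans (leq_addr _ _) rn).
  rewrite (smith_mul_top _ _ _ ni) sp ir Qr // mxE sp ir andbT -val_eqE /=.
  by case: eqP => _; rewrite ?mulr1 ?mulr0.
have [] := @smith_stack m n z r x p q sp sq rm rn xz.
- by move=> i /hpq[].
- move=> i iz; have ir : (i < r)%N by rewrite -(ltn_add2r x) (leq_ltn_trans _ iz) ?leq_add2l.
  by have [_] := hpq i ir; apply.
move=> U0 [B [bU bB eU UN]].
have [_ uU _] := bU; have [_ uB _] := bB.
pose C := invmx U0 *m (Q *m B2).
have bC : biproper_mx C.
  by apply: biproper_mulmx; [exact: biproper_invmx | exact: biproper_mulmx].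
have RC : R = B1 *m (smith_infty F m n p *m U0) *m C.
  rewrite /C !mulmxA -[_ *m U0 *m invmx U0]mulmxA (mulmxV uU) mulmx1.
  by rewrite -[B1 *m _ *m Q]mulmxA SQ -eR.
have CM (i : 'I_n) j : (i < r + x)%N -> (C *m M) i j = 0.
  rewrite /C -!mulmxA; set N := Q *m _ => ir.
  have -> : invmx U0 *m N = N by rewrite -{1}(UN _ N QN) (mulKmx uU).
  exact: QN.
clearbody C; have [_ uC _] := bC.
exists (smith_infty F z n q *m C); set W := _ *m C.
have [L bL eRW] : exists2 L : 'M[K]_(m + z),
    biproper_mx L & col_mx R W = L *m smith_infty F (m + z) n q *m C.
  exists (block_mx B1 0 0 1%:M *m B).
    by apply: biproper_mulmx bB; apply: biproper_block.
  rewrite -(mulmxA _ B) -eU mul_block_col !mul0mx addr0 add0r mul1mx mul_col_mx.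
  by rewrite -RC.
have [_ uL _] := bL.
have rk : \rank (col_mx R W) = (r + x)%N.
  have fC : row_free C by rewrite row_free_unit; exact: uC.
  have fL : row_full L by rewrite row_full_unit; exact: uL.
  by rewrite eRW (mxrankMfree _ fC) (eqmxMfull _ fL) rank_smith sq //; apply: leq_add.
split=> //.
  by split; [exact: sortq | rewrite rk | exists L, C].
have WM : col_mx R W *m M = 0.
  rewrite mul_col_mx RM -mulmxA (smith_mul0 z (N := C *m M)) ?col_mx0 // => i j.
  by rewrite sq; apply: CM.
apply/eqP; rewrite eq_sym eqEdim; apply/andP; split.
  rewrite -(span_basis (vbasisP V)); apply/span_subvP => _ /tnthP[j ->].
  by rewrite mem_lker -colM mulmx_col WM; apply/eqP/matrixP => i k; rewrite !mxE.
by apply: leq_trans (dim_lker_leq _) _; rewrite rk leq_subLR addnC dV.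
Qed.

(** * Degrees of polynomial vectors *)

Section MinimalBases.

Variable n : nat.
Implicit Types (U V : {vspace 'cV[K]_n}).

Lemma vdeg_leq (v : 'cV[{poly F}]_n) D :
  (vdeg v <= D)%N = [forall i, (psize (v i ord0) <= D.+1)%N].
Proof.
apply/bigmax_leqP/forallP => h i; first by have := h i isT; case: (psize _).
by move=> _; have := h i; case: (psize _).
Qed.

Lemma psize_vdeg (v : 'cV[{poly F}]_n) i : (psize (v i ord0) <= (vdeg v).+1)%N.
Proof. by have := leqnn (vdeg v); rewrite {1}vdeg_leq => /forallP. Qed.

Lemma vdeg0 : vdeg (0 : 'cV[{poly F}]_n) = 0%N.
Proof. by apply/eqP; rewrite -leqn0 vdeg_leq; apply/forallP => i; rewrite mxE size_poly0. Qed.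

Lemma vdegD_leq (v w : 'cV[{poly F}]_n) D :
  (vdeg v <= D)%N -> (vdeg w <= D)%N -> (vdeg (v + w)%R <= D)%N.
Proof.
rewrite !vdeg_leq => /forallP hv /forallP hw; apply/forallP => i; rewrite mxE.
by apply: leq_trans (size_polyD _ _) _; rewrite geq_max hv hw.
Qed.

Lemma vdeg_sum_leq (I : finType) (P : pred I) (f : I -> 'cV[{poly F}]_n) D :
  (forall i, P i -> vdeg (f i) <= D)%N -> (vdeg (\sum_(i | P i) f i)%R <= D)%N.
Proof.
move=> h; elim/big_ind: _ => //; first by rewrite vdeg0.
by move=> v w; apply: vdegD_leq.
Qed.

Lemma scalevE (p : {poly F}) (v : 'cV[{poly F}]_n) i :
  (p *: v) i ord0 = p * v i ord0.
Proof. by rewrite mxE. Qed.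

Lemma vdegZ_leq (p : {poly F}) (v : 'cV[{poly F}]_n) D :
  (p != 0 -> ((psize p).-1 + vdeg v <= D)%N) -> (vdeg (p *: v)%R <= D)%N.
Proof.
have [->|p0 /(_ isT) h] := eqVneq p 0; first by rewrite scale0r vdeg0.
rewrite vdeg_leq; apply/forallP => i; rewrite scalevE.
apply: leq_trans (size_mulf_leq _ _) _.
have := psize_vdeg v i; move: p0 h; rewrite -psize_gt0; lia.
Qed.

Lemma vdegZ (p : {poly F}) (v : 'cV[{poly F}]_n) :
  p != 0 -> v != 0 -> vdeg (p *: v) = ((psize p).-1 + vdeg v)%N.
Proof.
move=> p0 v0; apply/eqP; rewrite eqn_leq vdegZ_leq //=.
have [i vi] : exists i, v i ord0 != 0.
  apply/existsP; apply: contraNT v0; rewrite negb_exists => /forallP h.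
  by apply/eqP/matrixP => i j; rewrite ord1 mxE; have /negPn/eqP := h i.
have szp := p0; rewrite -psize_gt0 in szp.
have : (vdeg v <= (vdeg (p *: v)%R - (psize p).-1))%N.
  rewrite vdeg_leq; apply/forallP => k.
  have [->|vk] := eqVneq (v k ord0) 0; first by rewrite size_poly0.
  have := psize_vdeg (p *: v) k; rewrite scalevE size_mulf //; lia.
have := psize_vdeg (p *: v) i; rewrite scalevE size_mulf //.
move: vi; rewrite -psize_gt0; lia.
Qed.

Lemma tofvZ (p : {poly F}) (v : 'cV[{poly F}]_n) : tofv (p *: v) = p%:F *: tofv v.
Proof. exact: map_mxZ. Qed.

Lemma tofv_sum (I : finType) (f : I -> 'cV[{poly F}]_n) :
  tofv (\sum_i f i) = \sum_i tofv (f i).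
Proof. exact: raddf_sum. Qed.

Lemma tofv_inj : injective (tofv : 'cV[{poly F}]_n -> 'cV[K]_n).
Proof.
move=> v w /matrixP h; apply/matrixP => i j; have := h i j.
by rewrite !mxE => /eqP; rewrite tofrac_eq => /eqP.
Qed.

Lemma scalev_inj (p : {poly F}) (v w : 'cV[{poly F}]_n) :
  p != 0 -> p *: v = p *: w -> v = w.
Proof.
move=> p0 e; apply: tofv_inj; apply: (scalerI (_ : p%:F != 0)).
  by rewrite tofrac_eq0.
by rewrite -!tofvZ e.
Qed.

Lemma size_sub_lead (p : {poly F}) :
  (psize (p - lead_coef p *: 'X^((psize p).-1))%R <= (psize p).-1)%N.
Proof.
apply/leq_sizeP => j; rewrite coefB coefZ coefXn leq_eqVlt => /orP[/eqP <-|lt].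
  by rewrite eqxx mulr1 subrr.
rewrite gtn_eqF // mulr0 subr0 nth_default //.
by move: lt; case: (psize p).
Qed.

(** * Minimal bases and degree dominance *)

Section Tuple.

Variable t : nat.
Implicit Types b : t.-tuple 'cV[{poly F}]_n.

Definition coordf b (i : 'I_t) (v : 'cV[K]_n) : K := coord (map_tuple tofv b) i v.

Lemma coordf_sum U b (k : 'I_t -> K) j : poly_basis U b ->
  coordf b j (\sum_i k i *: tofv (tnth b i)) = k j.
Proof.
move=> /basis_free fb; rewrite -(coord_sum_free k j fb); congr (coord _ _ _).
by apply: eq_bigr => i _; rewrite -tnth_nth tnth_map.
Qed.

Lemma coordf_basis U b v : poly_basis U b -> v \in U ->
  v = \sum_i coordf b i v *: tofv (tnth b i).
Proof.
move=> hb vU; rewrite {1}(coord_basis hb vU); apply: eq_bigr => i _.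
by rewrite -tnth_nth tnth_map.
Qed.

Lemma coordf_tnth U b i j : poly_basis U b ->
  coordf b i (tofv (tnth b j)) = (i == j)%:R.
Proof.
move=> hb; rewrite -(coordf_sum (fun l => (l == j)%:R) i hb); congr coordf.
by rewrite (bigD1 j) //= eqxx scale1r big1 ?addr0 // => l /negPf ->; rewrite scale0r.
Qed.

Lemma coordf_neq0 b i (w : 'cV[{poly F}]_n) : coordf b i (tofv w) != 0 -> w != 0.
Proof.
apply: contraNneq => ->; rewrite [X in coordf _ _ X](_ : _ = 0); last exact: raddf0.
by rewrite /coordf linear0.
Qed.

Lemma poly_basis_mem U b i : poly_basis U b -> tofv (tnth b i) \in U.
Proof. by move=> hb; apply: (basis_mem hb); apply: map_f; apply: mem_tnth. Qed.

(** The exchange property that characterizes minimal bases among polynomial bases,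
see [minimal_dominant] and [dominant_minimal]. *)
Definition degree_dominant U b := forall (w : 'cV[{poly F}]_n) i,
  tofv w \in U -> coordf b i (tofv w) != 0 -> (vdeg (tnth b i) <= vdeg w)%N.

(** A violating vector w could replace the basis vector of larger degree. *)
Lemma minimal_dominant U b : minimal_basis U b -> degree_dominant U b.
Proof.
move=> [hb bmin] w i wU ai; rewrite leqNgt; apply/negP => lt.
pose b' := [tuple if j == i then w else tnth b j | j < t].
have b'E j : tnth b' j = if j == i then w else tnth b j by rewrite tnth_mktuple.
have mem' j : tofv (tnth b' j) \in <<map tofv b'>>%VS.
  by apply: memv_span; apply: map_f; apply: mem_tnth.
have hb' : poly_basis U b'.
  rewrite /poly_basis basisEdim -(span_basis hb) size_map size_tuple.
  rewrite (span_basis hb) (size_basis (hb : basis_of U (map_tuple tofv b))) leqnn andbT.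
  rewrite -{1}(span_basis hb); apply/span_subvP => v /mapP[u /tnthP[j ->] ->].
  have [->|ji] := eqVneq j i; last by have := mem' j; rewrite b'E (negPf ji).
  have := coordf_basis hb wU; rewrite (bigD1 i) //= => /eqP; rewrite -subr_eq => /eqP.
  move=> /(congr1 (fun v => (coordf b i (tofv w))^-1 *: v)).
  rewrite /= scalerA mulVf // scale1r => <-.
  apply/memvZ/memvB; first by have := mem' i; rewrite b'E eqxx.
  apply: memv_suml => l li; apply: memvZ.
  by have := mem' l; rewrite b'E (negPf li).
have := bmin _ hb'; rewrite !big_tuple (bigD1 i) //= [X in (_ <= X)%N -> _](bigD1 i) //=.
rewrite b'E eqxx [X in (_ <= _ + X)%N -> _](eq_bigr (fun j => vdeg (tnth b j))) => [|j ji];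
  last by rewrite b'E (negPf ji).
by rewrite leq_add2r leqNgt lt.
Qed.

(** The invertible matrix expressing another polynomial basis in terms of b has a
nonzero Leibniz term; this matches the two bases so that each vector of b has at
most the degree of its partner. *)
Lemma dominant_minimal U b : poly_basis U b -> degree_dominant U b -> minimal_basis U b.
Proof.
move=> hb dom; split=> // s hs.
have es : size s == t.
  have := size_basis (hs : basis_of U (map_tuple tofv (in_tuple s))).
  by rewrite (size_basis (hb : basis_of U (map_tuple tofv b))) => ->.
pose b' := Tuple es; have hb' : poly_basis U b' by [].
rewrite -[s]/(val b') !big_tuple.
pose A := \matrix_(i, j) coordf b i (tofv (tnth b' j)).
pose C := \matrix_(i, j) coordf b' i (tofv (tnth b j)).
have AC : A *m C = 1%:M.
  apply/matrixP => i j; rewrite !mxE.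
  have e : tofv (tnth b j) = \sum_k (A *m C) k j *: tofv (tnth b k).
    rewrite {1}(coordf_basis hb' (poly_basis_mem j hb)).
    under eq_bigr => l _ do rewrite {1}(coordf_basis hb (poly_basis_mem l hb')) scaler_sumr.
    rewrite exchange_big /=; apply: eq_bigr => k _; rewrite mxE scaler_suml.
    by apply: eq_bigr => l _; rewrite !mxE scalerA mulrC.
  have := congr1 (coordf b i) e; rewrite (coordf_sum _ _ hb) mxE => <-.
  by rewrite (coordf_tnth _ _ hb).
have [uA _] := mulmx1_unit AC.
have [s0 s0P] : exists s0 : 'S_t, \prod_i A i (s0 i) != 0.
  apply/existsP; apply: contraTT uA; rewrite negb_exists => /forallP h.
  rewrite unitmxE unitfE negbK; apply/eqP; rewrite /determinant big1 // => s0 _.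
  by have /negPn/eqP -> := h s0; rewrite mulr0.
rewrite [X in (_ <= X)%N](reindex_inj (@perm_inj _ s0)) /=; apply: leq_sum => i _.
apply: dom; first exact: poly_basis_mem.
by have /prodf_neq0/(_ i isT) := s0P; rewrite mxE.
Qed.

(** Subtracting the polynomial parts of the coordinates leaves a polynomial vector
w' whose coordinates rho_i / g are strictly proper fractions. Its degree is then
less than that of the largest basis vector involved, against dominance. *)
Lemma dominant_coord_poly U b (w : 'cV[{poly F}]_n) :
  poly_basis U b -> degree_dominant U b -> tofv w \in U ->
  exists a : 'I_t -> {poly F}, w = \sum_i a i *: tnth b i.
Proof.
move=> hb dom wU.
have [g [a [g0 ha]]] := common_denom (fun i => coordf b i (tofv w)).
have gw : g *: w = \sum_i a i *: tnth b i.
  apply: tofv_inj; rewrite tofvZ tofv_sum {1}(coordf_basis hb wU) scaler_sumr.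
  apply: eq_bigr => i _; rewrite tofvZ scalerA ha mulrC divfK // tofrac_eq0 //.
pose e (i : 'I_t) : {poly F} := a i %/ g; pose rho (i : 'I_t) : {poly F} := a i %% g.
pose w' : 'cV[{poly F}]_n := w - \sum_i e i *: tnth b i.
have gw' : g *: w' = \sum_i rho i *: tnth b i.
  rewrite /w' scalerBr gw scaler_sumr -sumrB; apply: eq_bigr => i _.
  by rewrite scalerA -scalerBl {1}(divp_eq (a i) g) [g * _]mulrC addrC addKr.
case: (boolP [exists i, rho i != 0]) => [/existsP[i0 r0]|]; last first.
  rewrite negb_exists => /forallP h; exists e.
  apply/eqP; rewrite -subr_eq0; apply/eqP; apply: (scalev_inj g0).
  rewrite -/w' gw' scaler0 big1 // => i _.
  by have /negPn/eqP -> := h i; rewrite scale0r.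
pose i := [arg max_(i > i0 | rho i != 0%R) vdeg (tnth b i)]%N.
have [ri0 imax] : rho i != 0 /\ forall l, rho l != 0 -> (vdeg (tnth b l) <= vdeg (tnth b i))%N.
  by rewrite /i; case: arg_maxnP.
have w'E : tofv w' = \sum_i ((rho i)%:F / g%:F) *: tofv (tnth b i).
  have g0' : g%:F != 0 :> K by rewrite tofrac_eq0.
  apply: (scalerI g0'); rewrite -tofvZ gw' tofv_sum scaler_sumr; apply: eq_bigr => l _.
  by rewrite tofvZ scalerA mulrC divfK.
have w'U : tofv w' \in U.
  by rewrite w'E; apply: memv_suml => l _; apply/memvZ/poly_basis_mem.
have ci : coordf b i (tofv w') != 0.
  by rewrite w'E (coordf_sum _ _ hb) mulf_neq0 ?invr_eq0 ?tofrac_eq0.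
have w'0 := coordf_neq0 ci.
have lerho l : rho l != 0 -> ((psize (rho l)).-1 < (psize g).-1)%N.
  move=> rl; have : (psize (rho l) < psize g)%N by rewrite ltn_modp.
  by move: rl; rewrite -psize_gt0; lia.
have := dom w' i w'U ci; rewrite leqNgt => /negP; case.
have : (vdeg (g *: w') <= (psize g).-1.-1 + vdeg (tnth b i))%N.
  rewrite gw'; apply: vdeg_sum_leq => l _; apply: vdegZ_leq => rl.
  by have := lerho l rl; have := imax l rl; lia.
by rewrite vdegZ //; have := lerho i ri0; lia.
Qed.

(** Predictable degree: if the leading terms of the summands of top degree
cancelled, these leading terms alone, divided by a power of s, would form a vector
w2 of degree less than that of a basis vector involved in it. *)
Lemma dominant_coord_degree U b (a : 'I_t -> {poly F}) i :
  poly_basis U b -> degree_dominant U b -> a i != 0 ->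
  ((psize (a i)).-1 + vdeg (tnth b i) <= vdeg (\sum_i a i *: tnth b i))%N.
Proof.
move=> hb dom ai0; set w : 'cV[{poly F}]_n := \sum_i _.
pose dg l := ((psize (a l)).-1 + vdeg (tnth b l))%N.
pose i1 := [arg max_(l > i | a l != 0%R) dg l]%N.
have [ai1 i1max] : a i1 != 0 /\ forall l, a l != 0 -> (dg l <= dg i1)%N.
  by rewrite /i1; case: arg_maxnP.
apply: leq_trans (i1max i ai0) _; rewrite leqNgt; apply/negP => lt.
(* S collects the summands of top degree, and i2 has the largest basis degree
   among them, so the powers of s in w2 have nonnegative exponents. *)
pose S l := (a l != 0) && (dg l == dg i1).
pose i2 := [arg max_(l > i1 | S l) vdeg (tnth b l)]%N.
have [Si2 i2max] : S i2 /\ forall l, S l -> (vdeg (tnth b l) <= vdeg (tnth b i2))%N.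
  by rewrite /i2; case: arg_maxnP => //; rewrite /S ai1 eqxx.
pose ld l : {poly F} :=
  if S l then lead_coef (a l) *: 'X^(vdeg (tnth b i2) - vdeg (tnth b l)) else 0.
pose w2 : 'cV[{poly F}]_n := \sum_l ld l *: tnth b l.
have w2E : tofv w2 = \sum_l (ld l)%:F *: tofv (tnth b l).
  by rewrite tofv_sum; apply: eq_bigr => l _; rewrite tofvZ.
have w2U : tofv w2 \in U.
  by rewrite w2E; apply: memv_suml => l _; apply/memvZ/poly_basis_mem.
have c2 : coordf b i2 (tofv w2) != 0.
  rewrite w2E (coordf_sum _ _ hb) tofrac_eq0 /ld Si2 subnn scaler_eq0 lead_coef_eq0 oner_eq0 orbF.
  by have /andP[] := Si2.
have w20 := coordf_neq0 c2.
have := dom w2 i2 w2U c2; rewrite leqNgt => /negP; case.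
pose m := (psize (a i2)).-1.
have m2 : (m + vdeg (tnth b i2) = dg i1)%N by have /andP[_ /eqP] := Si2.
have hX : 'X^m *: w2 = w - \sum_l
    (if S l then a l - lead_coef (a l) *: 'X^((psize (a l)).-1) else a l) *: tnth b l.
  rewrite /w2 scaler_sumr -sumrB; apply: eq_bigr => l _; rewrite scalerA -scalerBl; congr (_ *: _).
  rewrite /ld; case: ifP => Sl; last by rewrite mulr0 subrr.
  rewrite opprB addrC subrK -scalerAr -exprD; congr (_ *: 'X^_).
  by have := i2max l Sl; have /andP[_ /eqP] := Sl; rewrite -m2 /dg; lia.
have : (vdeg ('X^m *: w2) < dg i1)%N.
  have d0 : (0 < dg i1)%N by apply: leq_trans lt.
  rewrite -(prednK d0) ltnS hX; apply: vdegD_leq; first by rewrite -ltnS prednK.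
  rewrite -scaleN1r; apply: vdegZ_leq => _; rewrite [X in X.-1](_ : _ = 1%N) /=; last first.
    by rewrite size_polyN size_poly1.
  rewrite add0n; apply: vdeg_sum_leq => l _; apply: vdegZ_leq.
  case: ifP => Sl r0.
    have al0 : a l != 0 by have /andP[] := Sl.
    have /andP[_ /eqP dl] := Sl.
    have := size_sub_lead (a l); rewrite -dl /dg.
    move: r0 al0; rewrite -!psize_gt0; lia.
  rewrite -ltnS prednK // -/(dg l) ltn_neqAle i1max // andbT.
  by move: Sl; rewrite /S r0 => /negbT.
rewrite vdegZ ?monic_neq0 ?monicXn // [X in X.-1](_ : _ = m.+1); last exact: size_polyXn.
by rewrite -m2 ltn_add2l.
Qed.

End Tuple.

(** Sorting a minimal basis by degree lets its vectors be indexed like c. *)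
Lemma minimal_indices_tuple U (c : seq nat) t :
  size c = t -> minimal_indices U c ->
  exists b : t.-tuple 'cV[{poly F}]_n,
    [/\ poly_basis U b, degree_dominant U b & map (@vdeg F n) b = c].
Proof.
move=> sc [cs [b0 [hb0 b0min] cb0]].
pose b1 := sort (relpre (@vdeg F n) geq) b0.
have pb : perm_eq b1 b0 by rewrite perm_sort.
have e1 : map (@vdeg F n) b1 = c.
  apply: (@sorted_eq _ geq) => //.
  - by move=> y x z h1 h2; apply: leq_trans h2 h1.
  - by move=> x y /andP[h1 h2]; apply/eqP; rewrite eqn_leq; apply/andP.
  - by rewrite sorted_map; apply: sort_sorted => u v; apply: leq_total.
  - by rewrite perm_sym (permPl cb0) perm_sym perm_map.
have sb : size b1 == t by rewrite -(size_map (@vdeg F n)) e1 sc.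
exists (Tuple sb); have hb1 : poly_basis U b1.
  by rewrite /poly_basis (perm_basis (Y := map tofv b0)) //; apply: perm_map.
split=> //; apply: minimal_dominant; split=> // b' hb'.
by rewrite (perm_big _ pb); apply: b0min.
Qed.

Lemma minimal_indices_of_basis U t (b : t.-tuple 'cV[{poly F}]_n) c :
  poly_basis U b -> degree_dominant U b -> map (@vdeg F n) b = c -> sorted geq c ->
  minimal_indices U c.
Proof.
move=> hb dom e sc; split=> //; exists b; first exact: dominant_minimal.
by rewrite e.
Qed.

(** * Minimal indices of a subspace of a given space *)

Lemma dominant_drop U t (b : t.-tuple 'cV[{poly F}]_n) (w : 'cV[{poly F}]_n) j :
  poly_basis U b -> degree_dominant U b -> tofv w \in U ->
  (forall i, (i < j)%N -> (i < t)%N -> (vdeg w < vdeg b`_i)%N) ->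
  tofv w \in <<map tofv (drop j b)>>%VS.
Proof.
move=> hb dom wU h; rewrite (coordf_basis hb wU); apply: memv_suml => i _.
have [c0|c0] := eqVneq (coordf b i (tofv w)) 0; first by rewrite c0 scale0r mem0v.
have := dom w i wU c0; case: (ltnP i j) => [ij|ji _].
  by rewrite leqNgt (tnth_nth 0) h.
apply/memvZ/memv_span/map_f; rewrite (tnth_nth 0) -(subnKC ji) -nth_drop.
by apply: mem_nth; rewrite size_drop size_tuple ltn_sub2r // (leq_ltn_trans ji).
Qed.

Lemma dominant_drop_span U t (b : t.-tuple 'cV[{poly F}]_n) (s : seq 'cV[{poly F}]_n) j :
  poly_basis U b -> degree_dominant U b ->
  (forall w, w \in s -> tofv w \in U) ->
  (forall w i, w \in s -> (i < j)%N -> (i < t)%N -> (vdeg w < vdeg b`_i)%N) ->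
  (<<map tofv s>> <= <<map tofv (drop j b)>>)%VS.
Proof.
move=> hb dom sU h; apply/span_subvP => _ /mapP[w ws ->].
by apply: (dominant_drop hb dom) => [|i ij it]; [apply: sU | apply: h].
Qed.

Lemma free_drop U t (b : t.-tuple 'cV[{poly F}]_n) i :
  poly_basis U b -> free (map tofv (drop i b)).
Proof.
move=> /basis_free; rewrite -{1}(cat_take_drop i b) map_cat; exact: catr_free.
Qed.

Lemma dim_drop U t (b : t.-tuple 'cV[{poly F}]_n) i :
  poly_basis U b -> \dim <<map tofv (drop i b)>> = (t - i)%N.
Proof.
by move=> /(@free_drop _ _ _ i)/eqP ->; rewrite size_map size_drop size_tuple.
Qed.

Lemma sorted_vdeg (s : seq 'cV[{poly F}]_n) i j :
  sorted geq (map (@vdeg F n) s) -> (i <= j)%N -> (j < size s)%N ->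
  (vdeg s`_j <= vdeg s`_i)%N.
Proof.
move=> ss ij js; have is_ := leq_ltn_trans ij js.
by have := sorted_geq_nth ss ij; rewrite size_map !(nth_map 0) //; apply.
Qed.

Lemma mem_drop_nth (s : seq 'cV[{poly F}]_n) i w :
  w \in drop i s -> exists2 j, (i <= j < size s)%N & w = s`_j.
Proof.
move=> /(nthP 0)[j js <-]; exists (i + j)%N; last by rewrite nth_drop.
by move: js; rewrite size_drop leq_addr /= ltn_subRL.
Qed.

(** By dominance in U, the last k - g vectors of b' lie in the span of the last
k - g vectors of b, so both families span the same space. If a degree were larger
in one family than at the same place in the other, dominance would squeeze too
many independent vectors into a smaller tail. *)
Lemma subspace_degrees U V k x g (b : (k + x).-tuple 'cV[{poly F}]_n)
    (b' : k.-tuple 'cV[{poly F}]_n) :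
  poly_basis U b -> degree_dominant U b -> sorted geq (map (@vdeg F n) b) ->
  poly_basis V b' -> degree_dominant V b' -> sorted geq (map (@vdeg F n) b') ->
  (V <= U)%VS ->
  (forall l, (l < g + x)%N -> (g < k)%N -> (vdeg b'`_g < vdeg b`_l)%N) ->
  forall i, (g <= i < k)%N -> vdeg b'`_i = vdeg b`_(i + x).
Proof.
move=> hb dom sb hb' dom' sb' VU hg i /andP[gi ik].
have b'U w : w \in (b' : seq _) -> tofv w \in U.
  by move=> wb; apply: (subvP VU); apply: (basis_mem hb'); apply: map_f.
have gk := leq_ltn_trans gi ik.
have eqs : <<map tofv (drop g b')>>%VS = <<map tofv (drop (g + x) b)>>%VS.
  apply/eqP; rewrite eqEdim (dim_drop _ hb) (dim_drop _ hb') subnDr leqnn andbT.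
  apply: (dominant_drop_span hb dom) => [w /mem_drop /b'U //|w l].
  move=> /mem_drop_nth[j /andP[gj jk] ->] lg _; apply: leq_ltn_trans (hg l lg gk).
  exact: sorted_vdeg.
apply/eqP; rewrite eqn_leq; apply/andP; split; rewrite leqNgt; apply/negP => lt.
  have sub : (<<map tofv (drop (i + x) b)>> <= <<map tofv (drop i.+1 b')>>)%VS.
    apply: (dominant_drop_span hb' dom') => [w|w l].
      move=> /mem_drop_nth[j /andP[ij jk] ->]; rewrite -(span_basis hb').
      have : tofv b`_j \in <<map tofv (drop g b')>>%VS.
        rewrite eqs; apply/memv_span/map_f.
        have gj : (g + x <= j)%N by apply: leq_trans ij; rewrite leq_add2r.
        rewrite -(subnKC gj) -nth_drop mem_nth // size_drop ltn_sub2r //.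
        exact: leq_ltn_trans gj jk.
      by apply: subvP; apply: sub_span => y /mapP[u /mem_drop ub ->]; apply: map_f.
    move=> /mem_drop_nth[j /andP[ij jk] ->] li _.
    apply: leq_ltn_trans (leq_trans lt (sorted_vdeg sb' _ _)).
    + exact: sorted_vdeg.
    + by rewrite -ltnS.
    + by rewrite size_tuple.
  by have := dimvS sub; rewrite (dim_drop _ hb) (dim_drop _ hb') subnDr; move: ik; clear; lia.
have sub : (<<map tofv (drop i b')>> <= <<map tofv (drop (i + x).+1 b)>>)%VS.
  apply: (dominant_drop_span hb dom) => [w /mem_drop /b'U //|w l].
  move=> /mem_drop_nth[j /andP[ij jk] ->] li _.
  apply: leq_ltn_trans (leq_trans lt (sorted_vdeg sb _ _)).
  - exact: sorted_vdeg.
  - by rewrite -ltnS.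
  - by rewrite size_tuple ltn_add2r.
have := dimvS sub; rewrite (dim_drop _ hb) (dim_drop _ hb') -addSn subnDr; move: ik; clear; lia.
Qed.

(** * Realizing prescribed minimal indices *)

Lemma sum_pick (L : nmodType) (f : nat -> L) k m x :
  \sum_(j < k) (if m == (j + x)%N then f j else 0) =
  if (x <= m < k + x)%N then f (m - x)%N else 0.
Proof.
case: ifP => [/andP[xm mk]|h]; last first.
  rewrite big1 // => j _; case: eqP => // e; move: h.
  by rewrite e leq_addl ltn_add2r ltn_ord.
have mk' : (m - x < k)%N by rewrite ltn_subLR // addnC.
rewrite (bigD1 (Ordinal mk')) //= subnK // eqxx big1 ?addr0 // => j jm.
case: eqP => // e; case/eqP: jm; apply: val_inj => /=; by rewrite e addnK.
Qed.

(** The columns of the change of vectors: a diagonal of ones, preceded in the first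
g columns by an entry y. The ones, in the rows from x on, make it unimodular; the
entries y carry the degrees. *)
Definition band (L : pzSemiRingType) (x g : nat) (y : nat -> L) (i j : nat) : L :=
  if i == (j + x)%N then 1 else if (i.+1 == (j + x)%N) && (j < g)%N then y j else 0.

Lemma band_sum (L : pzSemiRingType) k x g (y c : nat -> L) i :
  (i < k + x)%N -> (g <= k)%N ->
  \sum_(j < k) band x g y i j * c j =
  (if (x <= i)%N then c (i - x)%N else 0) +
  (if (x <= i.+1)%N && (i.+1 - x < g)%N then y (i.+1 - x)%N * c (i.+1 - x)%N else 0).
Proof.
move=> ik gk.
transitivity (\sum_(j < k) (if i == (j + x)%N then c j else 0) +
  \sum_(j < k) (if i.+1 == (j + x)%N then if (j < g)%N then y j * c j else 0 else 0)).
  rewrite -big_split /=; apply: eq_bigr => j _; rewrite /band.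
  case: eqP => [e|_]; last by case: eqP => _ /=; do ?case: ifP => _; rewrite ?mul0r add0r.
  by rewrite mul1r; case: eqP => [e'|_]; rewrite ?addr0 //; have := n_Sn i; rewrite e' -e.
rewrite sum_pick (sum_pick (fun j => if (j < g)%N then y j * c j else 0)) ik andbT; congr (_ + _).
case: (leqP x i.+1) => //= xi; case: (ltnP (i.+1 - x) g) => h; last by case: ifP.
suff -> : (i.+1 < k + x)%N by [].
by rewrite -(subnK xi) ltn_add2r (leq_trans h gk).
Qed.

(** The diagonal of ones allows to solve for the c j by descending induction. It is
used for vanishing and for being a polynomial. *)
Lemma band_descent (L : pzRingType) (P : L -> Prop) k x g (y c : nat -> L) :
  (g <= k)%N -> P 0 -> (forall a l e, P a -> P e -> P (a - y l * e)) ->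
  (forall j, (k <= j)%N -> c j = 0) ->
  (forall i, (i < k + x)%N -> P (\sum_(j < k) band x g y i j * c j)) ->
  forall j, P (c j).
Proof.
move=> gk P0 PB c0 PA j; have [m] := ubnP (k - j); elim: m j => // m IH j.
case: (leqP k j) => [/c0 -> //|jk jm].
have := PA (j + x)%N; rewrite ltn_add2r => /(_ jk).
rewrite band_sum ?ltn_add2r // leq_addl addnK -addSn leq_addl addnK /=.
case: ifP => [_ Pa|_]; last by rewrite addr0.
have := PB _ j.+1 (c j.+1) Pa; rewrite addrK; apply; apply: IH.
by move: jk jm; clear; lia.
Qed.

Lemma tofrac_band (x g : nat) (y : nat -> {poly F}) i j :
  (band x g y i j)%:F = band x g (fun l => (y l)%:F) i j.
Proof. by rewrite /band; case: ifP => _; rewrite ?rmorph1 //; case: ifP; rewrite ?rmorph0. Qed.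

Section Construct.
Variables (U : {vspace 'cV[K]_n}) (k x g : nat).
Variables (b : (k + x).-tuple 'cV[{poly F}]_n) (d : seq nat).
Hypotheses (hb : poly_basis U b) (dom : degree_dominant U b).
Hypotheses (sb : sorted geq (map (@vdeg F n) b)) (sd : sorted geq d).
Hypotheses (szd : size d = k) (gk : (g <= k)%N).
Hypothesis low : forall j, (j < g)%N -> (0 < x)%N /\ (vdeg b`_(j + x).-1 <= nth 0%N d j)%N.
Hypothesis high : forall j, (g <= j < k)%N -> nth 0%N d j = vdeg b`_(j + x).

(** The exponent raises the degree of the vector of b before position j + x to
the prescribed d_j. *)
Definition mix_coef j : {poly F} := 'X^(nth 0%N d j - vdeg b`_(j + x).-1).
Definition mixed : k.-tuple 'cV[{poly F}]_n :=
  [tuple \sum_(i < k + x) band x g mix_coef i j *: tnth b i | j < k].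

Lemma mixed_sum (c : 'I_k -> K) :
  \sum_j c j *: tofv (tnth mixed j) =
  \sum_(i < k + x) (\sum_(j < k) band x g (fun l => (mix_coef l)%:F) i j * (mktuple c)`_j) *:
    tofv (tnth b i).
Proof.
under [RHS]eq_bigr => i _ do rewrite scaler_suml.
rewrite exchange_big /=; apply: eq_bigr => j _; rewrite tnth_mktuple tofv_sum scaler_sumr.
by apply: eq_bigr => i _; rewrite tofvZ scalerA nth_mktuple -tofrac_band mulrC.
Qed.

Lemma mktuple_default (c : 'I_k -> K) j : (k <= j)%N -> (mktuple c)`_j = 0.
Proof. by move=> kj; rewrite nth_default // size_tuple. Qed.

Lemma mixed_free : free (map tofv mixed).
Proof.
suff: free (map_tuple tofv mixed) by [].
apply/freeP => c e j.
have e0 : \sum_i c i *: tofv (tnth mixed i) = 0.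
  apply: etrans e; apply: eq_bigr => i _.
  by rewrite -tnth_nth [tnth (map_tuple tofv mixed) i]tnth_map.
rewrite mixed_sum in e0.
have := @band_descent _ (fun a => a = 0) k x g (fun l => (mix_coef l)%:F) (fun j => (mktuple c)`_j).
rewrite -(nth_mktuple c 0 j); apply=> //.
- by move=> a l e' -> ->; rewrite mulr0 subrr.
- exact: mktuple_default.
- move=> i ik; have := congr1 (coordf b (Ordinal ik)) e0; rewrite (coordf_sum _ _ hb) /= => ->.
  by rewrite /coordf linear0.
Qed.

Local Notation V := <<map tofv mixed>>%VS.

Lemma mixed_basis : poly_basis V mixed.
Proof. by rewrite /poly_basis /basis_of eqxx mixed_free. Qed.

Lemma mixed_sub : (V <= U)%VS.
Proof.
apply/span_subvP => _ /mapP[w /tnthP[j ->] ->]; rewrite tnth_mktuple tofv_sum.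
by apply: memv_suml => i _; rewrite tofvZ; apply/memvZ/poly_basis_mem.
Qed.

(** Let a and beta be the coordinates of w in b and in the new vectors. Both are
polynomial, the latter by descent. From position g on, beta is a coordinate of w
in b, whose degree is controlled by predictable degree. For the first g positions
one climbs up: s^e beta_i is the difference of such a coordinate and beta_(i-1),
and the degrees add up since d is decreasing. *)
Lemma mixed_degree (w : 'cV[{poly F}]_n) (j : 'I_k) :
  tofv w \in V -> coordf mixed j (tofv w) != 0 -> (nth 0%N d j <= vdeg w)%N.
Proof.
move=> wV cj0; pose c i := coordf mixed i (tofv w).
have wE : tofv w = _ := etrans (coordf_basis mixed_basis wV) (mixed_sum c).
have [a wa] := dominant_coord_poly hb dom (subvP mixed_sub _ wV).
pose A i : {poly F} := (mktuple a)`_i.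
have aE i : (i < k + x)%N ->
    (A i)%:F = \sum_(j < k) band x g (fun l => (mix_coef l)%:F) i j * (mktuple c)`_j.
  move=> ik; have := congr1 (coordf b (Ordinal ik)) wE; rewrite (coordf_sum _ _ hb) /= => <-.
  rewrite wa tofv_sum; under eq_bigr => l _ do rewrite tofvZ.
  by rewrite (coordf_sum (fun l => (a l)%:F) _ hb) -(nth_mktuple a 0).
have [beta bE] : exists beta : 'I_k -> {poly F}, forall i, c i = (beta i)%:F.
  apply: (@fin_all_exists _ (fun=> {poly F}) (fun i p => c i = p%:F)) => i.
  rewrite -(nth_mktuple c 0 i).
  apply: (@band_descent _ (fun e => exists p, e = p%:F) k x g (fun l => (mix_coef l)%:F)
            (fun j => (mktuple c)`_j)) => //.
  - by exists 0; rewrite rmorph0.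
  - by move=> _ l _ [p ->] [p' ->]; exists (p - mix_coef l * p'); rewrite rmorphB rmorphM.
  - exact: mktuple_default.
  - by move=> l lk; rewrite -aE //; exists (A l).
pose B i : {poly F} := (mktuple beta)`_i.
have BE i : (B i)%:F = (mktuple c)`_i.
  case: (ltnP i k) => ik; last by rewrite /B !nth_default ?size_tuple ?rmorph0.
  by rewrite /B -[i]/(val (Ordinal ik)) !nth_mktuple bE.
have AB i : (i < k + x)%N -> A i = (if (x <= i)%N then B (i - x)%N else 0) +
    (if (x <= i.+1)%N && (i.+1 - x < g)%N then mix_coef (i.+1 - x) * B (i.+1 - x)%N else 0).
  move=> ik; apply/eqP; rewrite -tofrac_eq aE // band_sum // tofracD; apply/eqP.
  by congr (_ + _); case: ifP => _; rewrite ?tofrac0 ?tofracM ?BE.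
have Adeg i : (i < k + x)%N -> A i != 0 -> (psize (A i) + vdeg b`_i <= (vdeg w).+1)%N.
  move=> ik; rewrite /A -[i]/(val (Ordinal ik)) nth_mktuple => a0.
  have := dominant_coord_degree hb dom a0; rewrite -wa (tnth_nth 0) /=.
  by move: a0; rewrite -psize_gt0; lia.
have claim_high i : (i < k)%N -> (g <= i)%N -> B i != 0 ->
    (psize (B i) + nth 0%N d i <= (vdeg w).+1)%N.
  move=> ik gi Bi; have ikx : (i + x < k + x)%N by rewrite ltn_add2r.
  have e : A (i + x)%N = B i.
    by rewrite AB // leq_addl addnK -addSn leq_addl addnK ltnNge (leqW gi) addr0.
  by rewrite high ?gi // -e; apply: Adeg; rewrite ?e.
have claim_low i R : (i < g)%N -> B i != 0 ->
    A (i + x).-1 = R + mix_coef i * B i ->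
    (psize R <= (vdeg w).+1 - vdeg b`_(i + x).-1)%N ->
    (psize (B i) + nth 0%N d i <= (vdeg w).+1)%N.
  move=> ig Bi e sR; have [x0 lo] := low ig.
  have sA : (psize (A (i + x).-1) <= (vdeg w).+1 - vdeg b`_(i + x).-1)%N.
    have [->|a0] := eqVneq (A (i + x).-1) 0; first by rewrite size_poly0.
    have ikx : ((i + x).-1 < k + x)%N by move: ig gk x0; clear; lia.
    by have := Adeg _ ikx a0; clear; lia.
  have : (psize (mix_coef i * B i)%R <= (vdeg w).+1 - vdeg b`_(i + x).-1)%N.
    have -> : mix_coef i * B i = A (i + x).-1 - R by rewrite e addrC addKr.
    by apply: leq_trans (size_polyD _ _) _; rewrite size_polyN geq_max sA sR.
  rewrite size_mulf //; last by rewrite monic_neq0 ?monicXn.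
  have -> : psize (mix_coef i) = (nth 0%N d i - vdeg b`_(i + x).-1).+1 by apply: size_polyXn.
  by move: Bi lo; rewrite -psize_gt0; clear; lia.
have AB_low i : (i < g)%N ->
    A (i + x).-1 = (if (0 < i)%N then B i.-1 else 0) + mix_coef i * B i.
  move=> ig; have [x0 lo] := low ig; have ik := leq_trans ig gk.
  rewrite AB; last by move: ik x0; clear; lia.
  rewrite prednK ?addn_gt0 ?x0 ?orbT // leq_addl addnK ig /=; congr (_ + _).
  move: (i) => [|i'] /=; first by rewrite add0n leqNgt prednK ?leqnn.
  by rewrite leq_addl addnK.
have claim i : (i < k)%N -> B i != 0 -> (psize (B i) + nth 0%N d i <= (vdeg w).+1)%N.
  elim: i => [|i IH] ik Bi.
    case: (leqP g 0) => [g0|g0]; first exact: claim_high.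
    by apply: (claim_low _ 0); rewrite ?AB_low ?size_poly0.
  case: (leqP g i.+1) => gi; first exact: claim_high.
  apply: (claim_low _ (B i)); rewrite ?AB_low //.
  have [->|Bi0] := eqVneq (B i) 0; first by rewrite size_poly0.
  have := IH (ltnW ik) Bi0; have [_] := low gi.
  have : (nth 0%N d i.+1 <= nth 0%N d i)%N.
    by apply: (sorted_geq_nth sd) => //; rewrite szd.
  by clear; lia.
have Bj : B j != 0 by rewrite -tofrac_eq0 BE nth_mktuple.
by have := claim j (ltn_ord j) Bj; move: Bj; rewrite -psize_gt0; lia.
Qed.

(** The lower bound on the degree is dominance applied to the vector itself. *)
Lemma vdeg_mixed (j : 'I_k) : vdeg (tnth mixed j) = nth 0%N d j.
Proof.
apply/eqP; rewrite eqn_leq mixed_degree ?(coordf_tnth _ _ mixed_basis) ?eqxx ?oner_eq0 ?andbT //;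
  last first.
  exact: (poly_basis_mem j mixed_basis).
have hi : (vdeg b`_(j + x) <= nth 0%N d j)%N.
  case: (leqP g j) => gj; first by rewrite high ?gj /=.
  have [_ lo] := low gj; apply: leq_trans lo; apply: sorted_vdeg sb _ _; first exact: leq_pred.
  by rewrite size_tuple ltn_add2r.
rewrite tnth_mktuple; apply: vdeg_sum_leq => i _; apply: vdegZ_leq; rewrite /band (tnth_nth 0).
case: (i =P (j + x)%N :> nat) => [-> _|_]; first by rewrite size_poly1.
case: ifP => [/andP[/eqP e gj] _|]; last by rewrite eqxx.
have [_ lo] := low gj; have -> : val i = (j + x).-1 by rewrite -e.
by rewrite /mix_coef [psize _]size_polyXn /= subnK.
Qed.

Lemma mixed_dominant : degree_dominant V mixed.
Proof. by move=> w j wV cj; rewrite vdeg_mixed; apply: mixed_degree. Qed.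

Lemma map_vdeg_mixed : map (@vdeg F n) mixed = d.
Proof.
apply: (@eq_from_nth _ 0%N) => [|i]; rewrite size_map size_tuple ?szd // => ik.
by rewrite (nth_map 0) ?size_tuple // -[i]/(val (Ordinal ik)) -tnth_nth vdeg_mixed.
Qed.

End Construct.

End MinimalBases.

End RationalMatrices.

Theorem theorem3p7 (F : fieldType) (m n r : nat) (R : 'M[ratfun F]_(m, n))
    (p : r.-tuple int) (c : (n - r).-tuple nat) (z x : nat)
    (q : (r + x).-tuple int) (d : (n - r - x).-tuple nat) (h : int) :
  \rank R = r ->
  invariant_orders_infty R p ->
  col_minimal_indices R c ->
  (x <= minn z (n - r))%N ->
  sorted <=%R (q : seq int) ->
  sorted geq d ->
  is_hx c d x h ->
  (exists W : 'M[ratfun F]_(z, n),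
      [/\ \rank (col_mx R W) = (r + x)%N,
          invariant_orders_infty (col_mx R W) q
        & col_minimal_indices (col_mx R W) d])
  <->
  ((forall i : int, h - x%:Z + 1 <= i -> i <= n%:Z - r%:Z - x%:Z ->
      decr_ext d i = decr_ext c (i + x%:Z)) /\
   (forall i : int, 1 <= i -> i <= r%:Z ->
      (incr_ext q i <= incr_ext p i)%E /\
      (incr_ext p i <= incr_ext q (i + z%:Z))%E)).
Proof.
move=> rR oR cR; rewrite leq_min => /andP[xz xnr] sq sd hh.
have rn : (r <= n)%N by rewrite -rR rank_leq_col.
have sdc : (size d + x)%N = size c by rewrite !size_tuple subnK.
have sc : sorted geq c by case: cR.
have [g [-> gd hlt hle]] := is_hx_nat sdc sc hh.
have et : n%:Z - r%:Z - x%:Z = (size d)%:Z by rewrite size_tuple; lia.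
have orders_iff := incr_ext_interlace z (size_tuple p) (size_tuple q).
have tail_iff := decr_ext_tail g sdc et.
have knx : (n - r - x + x)%N = size c by rewrite -sdc size_tuple.
have [b [hb dom eb]] := minimal_indices_tuple (esym knx) cR.
have nb i : (i < size c)%N -> vdeg b`_i = nth 0%N c i.
  by move=> ic; rewrite -eb (nth_map 0) // size_tuple knx.
split=> [[W [rW oW cW]]|[/tail_iff hd /orders_iff ho]].
  split; last first.
    apply/orders_iff => i ir; have := orders_interlace oR oW (i := i).
    by rewrite !size_tuple; apply.
  apply/tail_iff => j /andP[gj jd].
  have [b' [hb' dom' eb']] := minimal_indices_tuple (size_tuple d) cW.
  have nb' i : (i < size d)%N -> vdeg b'`_i = nth 0%N d i.
    by move=> id; rewrite -eb' (nth_map 0) // size_tuple -[X in (_ < X)%N](size_tuple d).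
  rewrite -nb' // -nb; last by rewrite -sdc ltn_add2r.
  apply: (subspace_degrees (g := g) hb dom _ hb' dom').
  - by rewrite eb.
  - by rewrite eb'.
  - exact: lker_col_mx.
  - move=> l lg gk; rewrite nb' ?size_tuple // nb; last first.
      by rewrite -knx; apply: leq_trans lg _; rewrite leq_add2r ltnW.
    by apply: hlt; rewrite ?size_tuple.
  - by rewrite gj /= -[X in (_ < X)%N](size_tuple d).
have gk : (g <= n - r - x)%N by rewrite -[X in (_ <= X)%N](size_tuple d).
have low j : (j < g)%N -> (0 < x)%N /\ (vdeg b`_(j + x).-1 <= nth 0%N d j)%N.
  move=> jg; have [x0 le] := hle j jg; split=> //; rewrite nb //.
  by rewrite -sdc; move: jg gd x0; clear; lia.
have high j : (g <= j < n - r - x)%N -> nth 0%N d j = vdeg b`_(j + x).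
  move=> /andP[gj]; rewrite -[X in (_ < X)%N](size_tuple d) => jd.
  by rewrite nb; [apply: hd; rewrite gj | rewrite -sdc ltn_add2r].
have sb : sorted geq (map (@vdeg F n) b) by rewrite eb.
pose V := <<map (map_mx (@tofrac {poly F})) (mixed g b d)>>%VS.
have hV : poly_basis V (mixed g b d) := mixed_basis d hb gk.
have [|W [rW oW kW]] := row_completion_exists (V := V) oR (size_tuple p) (size_tuple q)
  sq xz _ (mixed_sub g d hb) ho.
  have -> := size_basis (hV : basis_of V (map_tuple _ (mixed g b d))).
  by move: rn xnr; clear; lia.
exists W; split=> //; rewrite /col_minimal_indices kW.
apply: (minimal_indices_of_basis hV) => //.
- exact: (mixed_dominant hb dom sb sd (size_tuple d) gk low high).
- exact: (map_vdeg_mixed hb dom sb sd (size_tuple d) gk low high).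
Qed.
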